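(* Let $\mathfrak{g}$ be a finite dimensional simple complex Lie algebra, let $\alpha$ be a simple root and $k$ its coefficient in the decomposition of the maximal root $\alpha_{\max}$ as a combination of simple roots. Let $a(u)=\frac{1}{(1-c_1u)(1-c_2u)}$ for non-zero constants $c_1\neq c_2$ in $\mathbb{C}$. (i) If $k=1$, there exists a one-to-one correspondence between Lagrangian subalgebras $W$ of $\mathfrak{g}((u))$, with respect to $Q_{a(u)}$, which are transversal to $\mathfrak{g}[[u]]$ and satisfy $W\subseteq \mathbb{O}_{\alpha}\cap\mathfrak{g}[u,u^{-1}]$, and Lagrangian subalgebras in $\mathfrak{g}\oplus\mathfrak{g}$, with respect to $\bar{Q}$, transversal to $\Delta_{\alpha}$. (ii) If $k>1$, then there are no Lagrangian subalgebras $W$ of $\mathfrak{g}((u))$, with respect to $Q_{a(u)}$, which are transversal to $\mathfrak{g}[[u]]$ and satisfy $W\subseteq \mathbb{O}_{\alpha}\cap\mathfrak{g}[u,u^{-1}]$.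
   Context: $\mathfrak{g}$ has a fixed Cartan subalgebra $\mathfrak{h}$, root system $R$, set of simple roots $\Gamma=\{\alpha_i\}$, root spaces $\mathfrak{g}_\beta$, and maximal root $\alpha_{\max}=\sum_j k_j\alpha_j$. A root ''contains'' $\alpha$ if its coefficient at $\alpha$ in the expansion in simple roots is non-zero. $K$ denotes the Killing form of $\mathfrak{g}$, and also its $\mathbb{C}((u))$-bilinear extension to $\mathfrak{g}((u))$. The form on $\mathfrak{g}((u))$: $Q_{a(u)}(f_1,f_2)=\mathrm{Res}_{u=0}(a(u)K(f_1(u),f_2(u)))$, where $a(u)$ is regarded as a Taylor series at $u=0$. The maximal order $\mathbb{O}_\alpha$: let $\mathfrak{h}(\mathbb{R})=\{h\in\mathfrak{h}:\beta(h)\in\mathbb{R}\ \forall\beta\in R\}$, and let $v$ be the valuation on $\mathbb{C}((u^{-1}))$ with $v(\sum_{m\ge n}a_mu^{-m})=n$ when $a_n\ne0$ (and $v(0)=+\infty$). For $h\in\mathfrak{h}(\mathbb{R})$ and $\beta\in R$ put $M_\beta(h)=\{f\in\mathbb{C}((u^{-1})):v(f)\ge\beta(h)\}$ and $\mathbb{O}_h=\mathfrak{h}[[u^{-1}]]\oplus\bigoplus_{\beta\in R}M_\beta(h)\otimes\mathfrak{g}_\beta$. For $\alpha=\alpha_j$ set $\mathbb{O}_\alpha=\mathbb{O}_{h_j}$, where $h_j\in\mathfrak{h}(\mathbb{R})$ is defined by $\alpha_i(h_j)=\delta_{ij}/k_j$ for all $i$. The intersection $\mathbb{O}_\alpha\cap\mathfrak{g}[u,u^{-1}]$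 is taken in $\mathfrak{g}((u^{-1}))$, and $\mathfrak{g}[u,u^{-1}]$ is also viewed inside $\mathfrak{g}((u))$. The form on $\mathfrak{g}\oplus\mathfrak{g}$: $\bar{Q}((x_1,y_1),(x_2,y_2))=K(x_1,x_2)-K(y_1,y_2)$. $P_\alpha^-$ is the standard parabolic subalgebra of $\mathfrak{g}$ spanned by $\mathfrak{h}$, the root spaces of all negative roots and the root spaces of all positive roots which do not contain $\alpha$. Its reductive part is the subalgebra spanned by $\mathfrak{h}$ and the root spaces of all roots not containing $\alpha$; the reductive part of an element of $P_\alpha^-$ is its component there along the decomposition of $P_\alpha^-$ as reductive part plus the sum of the root spaces of negative roots containing $\alpha$. $\Delta_\alpha$ is the set of pairs $(x,y)\in P_\alpha^-\times P_\alpha^-$ having the same reductive parts. A Lie subalgebra $W$ is Lagrangian with respect to a nondegenerate invariant bilinear form if $W=W^\perp$. Two subspaces are transversal if the ambient space is their direct sum. *)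

(* Defs.v *)
From mathcomp Require Import all_boot all_order all_algebra.
From mathcomp Require Import all_classical all_reals complex.

Set Implicit Arguments.
Unset Strict Implicit.
Unset Printing Implicit Defensive.

Import Order.TTheory GRing.Theory Num.Theory.

Local Open Scope classical_set_scope.
Local Open Scope ring_scope.

Section LinearAlgebra.
Variables (F : fieldType) (U : lmodType F).

Definition is_subspace (W : set U) : Prop :=
  W 0 /\ forall (a : F) (x y : U), W x -> W y -> W (a *: x + y).

Definition lspan (A : set U) : set U := smallest is_subspace A.

Definition transversal_in (V A B : set U) : Prop :=
  A `&` B = [set 0] /\ [set a + b | a in A & b in B] = V.

Definition orthogonal_in (V : set U) (Q : U -> U -> F) (W : set U) : set U :=
  [set x | V x /\ forall y, W y -> Q x y = 0].

(* The Lie algebra and its form live on a subset V of U, given by the total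
   operations br and Q on U. *)
Definition lagrangian_subalgebra
    (V : set U) (br : U -> U -> U) (Q : U -> U -> F) (W : set U) : Prop :=
  [/\ W `<=` V, is_subspace W, (forall x y, W x -> W y -> W (br x y)) &
      W = orthogonal_in V Q W].

End LinearAlgebra.

(* Bilinearity of the bracket is carried by the type of [lie_ad]. *)
Record lie_algebra (F : fieldType) (g : vectType F) := LieAlgebra {
  lie_ad : 'Hom(g, 'End(g));
  lie_alternating : forall x, lie_ad x x = 0;
  lie_jacobi : forall x y z,
    lie_ad x (lie_ad y z) + lie_ad y (lie_ad z x) + lie_ad z (lie_ad x y) = 0
}.

Section LieAlgebras.
Variables (F : fieldType) (g : vectType F) (L : lie_algebra g).

Definition lie_br (x y : g) : g := lie_ad L x y.

Definition lfun_trace (f : 'End(g)) : F :=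
  \tr (passmx.mxof (vbasis {:g}) (vbasis {:g}) f).

Definition killing (x y : g) : F := lfun_trace (lie_ad L x \o lie_ad L y)%VF.

Definition is_ideal (I : {vspace g}) : Prop :=
  forall x y, y \in I -> lie_br x y \in I.

Definition is_simple : Prop :=
  (exists x y, lie_br x y != 0) /\
  (forall I : {vspace g}, is_ideal I -> I = 0%VS \/ I = fullv).

Definition lie_prodv (A B : {vspace g}) : {vspace g} :=
  <<[seq lie_br x y | x <- vbasis A, y <- vbasis B]>>%VS.

Definition is_subalgebra (H : {vspace g}) : Prop :=
  forall x y, x \in H -> y \in H -> lie_br x y \in H.

Definition is_nilpotent (H : {vspace g}) : Prop :=
  exists n, iter n (lie_prodv H) H = 0%VS.

Definition is_cartan (H : {vspace g}) : Prop :=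
  [/\ is_subalgebra H, is_nilpotent H &
      forall x, (forall y, y \in H -> lie_br x y \in H) -> x \in H].

Definition dual_space (H : {vspace g}) := 'Hom(subvs_of H, F^o).

Section Roots.
Variable H : {vspace g}.

Definition root_space (b : dual_space H) : set g :=
  [set x | forall h : subvs_of H, lie_br (vsval h) x = b h *: x].

Definition is_root (b : dual_space H) : Prop :=
  b != 0 /\ exists2 x, root_space b x & x != 0.

Section SimpleRoots.
Variables (r : nat) (Gamma : r.-tuple (dual_space H)).

Definition nonneg_comb (b : dual_space H) : Prop :=
  exists n : 'I_r -> nat, b = \sum_i (n i)%:R *: tnth Gamma i.

Definition is_simple_system : Prop :=
  [/\ basis_of fullv Gamma,
      (forall i, is_root (tnth Gamma i)) &
      (forall b, is_root b -> nonneg_comb b \/ nonneg_comb (- b))].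

Definition positive_root (b : dual_space H) : Prop := is_root b /\ nonneg_comb b.

Definition negative_root (b : dual_space H) : Prop := is_root b /\ nonneg_comb (- b).

(* Maximality is for the partial order b <= c defined by nonneg_comb (c - b). *)
Definition is_maximal_root (theta : dual_space H) : Prop :=
  is_root theta /\ forall b, is_root b -> nonneg_comb (theta - b).

Definition contains (j : 'I_r) (b : dual_space H) : Prop := coord Gamma j b != 0.

Variable j : 'I_r.

Definition parabolic : set g :=
  lspan ([set` H] `|`
         \bigcup_(b in [set b | negative_root b \/
                                positive_root b /\ ~ contains j b])
            root_space b).

Definition reductive_part : set g :=
  lspan ([set` H] `|`
         \bigcup_(b in [set b | is_root b /\ ~ contains j b]) root_space b).

Definition parabolic_nilradical : set g :=
  lspan (\bigcup_(b in [set b | negative_root b /\ contains j b])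
            root_space b).

Definition has_reductive_component (x l : g) : Prop :=
  reductive_part l /\ parabolic_nilradical (x - l).

Definition Delta : set (g * g) :=
  [set p | [/\ parabolic p.1, parabolic p.2 &
      exists2 l, has_reductive_component p.1 l & has_reductive_component p.2 l]].

End SimpleRoots.
End Roots.

Definition lie_br2 (p q : g * g) : g * g :=
  (lie_br p.1 q.1, lie_br p.2 q.2).

Definition Qbar (p q : g * g) : F := killing p.1 q.1 - killing p.2 q.2.

End LieAlgebras.

(* V((u)), V[[u]], V((u^-1)), V[[u^-1]] and V[u,u^-1] are all realized as sets
   of functions f : int -> V, with f n the coefficient of u^n. *)
Section Series.
Variable V : nmodType.

Definition laurent : set (int -> V) :=
  [set f | exists N : int, forall n, n < N -> f n = 0].

Definition taylor : set (int -> V) := [set f | forall n, n < 0 -> f n = 0].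

Definition laurent_inv : set (int -> V) :=
  [set f | exists N : int, forall n, N < n -> f n = 0].

Definition laurent_poly : set (int -> V) := laurent `&` laurent_inv.

End Series.

(* Extension to series of a bilinear map op: the sum has finite support when
   both series belong to the same space of Laurent series. *)
Definition conv (A B C : nmodType) (op : A -> B -> C)
    (f : int -> A) (h : int -> B) : int -> C :=
  fun n => \sum_(i \in [set: int]) op (f i) (h (n - i)).

Section LoopAlgebra.
Variables (F : fieldType) (g : vectType F) (L : lie_algebra g).

Definition residue (f : int -> F) : F := f (-1).

Definition Qform (a : int -> F) (f1 f2 : int -> g) : F :=
  residue (conv *%R a (conv (killing L) f1 f2)).

(* Taylor expansion at u = 0 of 1 / (1 - c u). *)
Definition geometric (c : F) : int -> F :=
  fun n => if n is Posz m then c ^+ m else 0.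

(* Taylor expansion at u = 0 of 1 / ((1 - c1 u) (1 - c2 u)). *)
Definition a_series (c1 c2 : F) : int -> F :=
  conv *%R (geometric c1) (geometric c2).

End LoopAlgebra.

(* The valuation of f in F((u^-1)) is n; the coefficient of u^-m is f (- m). *)
Definition has_valuation (F : fieldType) (f : int -> F) (n : int) : Prop :=
  f (- n) != 0 /\ forall m, m < n -> f (- m) = 0.

Section Orders.
Variables (F : numFieldType) (g : vectType F) (L : lie_algebra g).
Variable H : {vspace g}.

Definition h_real : set (subvs_of H) :=
  [set h | forall b : dual_space H, is_root L b -> b h \is Num.real].

Definition M_ (b : dual_space H) (h : subvs_of H) : set (int -> F) :=
  [set f | @laurent_inv F f /\
           (f = 0 \/ exists2 n, has_valuation f n & b h <= n%:~R)].

Definition M_tensor (b : dual_space H) (h : subvs_of H) : set (int -> g) :=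
  lspan [set f | exists m x,
    [/\ M_ b h m, root_space L b x & f = (fun n => m n *: x)]].

Definition h_taylor_inv : set (int -> g) :=
  [set f | (forall n, f n \in H) /\ forall n, 0 < n -> f n = 0].

Definition O_ (h : subvs_of H) : set (int -> g) :=
  lspan (h_taylor_inv `|` \bigcup_(b in @is_root F g L H) M_tensor b h).

(* h is the element h_j which defines the maximal order O_alpha for the j-th
   simple root alpha, of coefficient k in the maximal root. *)
Definition is_order_point (r : nat) (Gamma : r.-tuple (dual_space H)) (j : 'I_r)
    (k : nat) (h : subvs_of H) : Prop :=
  h_real h /\ forall i, tnth Gamma i h = (i == j)%:R / k%:R.

End Orders.

(* Main.v *)
Require Import Defs.
From HB Require Import structures.
From mathcomp Require Import all_boot all_order all_algebra.
From mathcomp Require Import all_classical all_reals complex.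
From mathcomp Require Import zify ring.

Set Implicit Arguments.
Unset Strict Implicit.
Unset Printing Implicit Defensive.

Import Order.TTheory GRing.Theory Num.Theory.

Local Open Scope classical_set_scope.
Local Open Scope ring_scope.

(** A simple Lie algebra has a Killing form [K] that is nondegenerate or zero. If [K]
    is zero, then a Lagrangian subspace is the whole ambient space, which is
    transversal to no non-zero subspace; both families of subalgebras are empty
    ([zero_killing_loop], [zero_killing_square]).

    Suppose that [K] is nondegenerate. Then [g] is spanned by [H] and the root spaces
    ([root_decomposition]). Indeed [H] is abelian, because brackets of its elements
    act by zero on the root vectors of the simple roots, and [ad t] is semisimple for
    [t] in [H], because its semisimple part is a derivation and derivations are
    inner. Moreover [K] pairs [g_b] with [g_-b] ([root_opp]), so the negative of a
    root is a root, and maximality puts the coefficient at [alpha] of every root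
    between [- k] and [k].

    Let [k = 1]. The eigenvalues of [ad h] grade [g] by the weights [-1], [0], [1], and
    [O_alpha] intersects [g[u, u^-1]] in the sum [D] of the spaces [u^-m g_m[u^-1]]
    ([order_filtered]). The evaluation of Laurent polynomials at the poles [c1^-1] and
    [c2^-1] of [a(u)] is a homomorphism from [D] onto [g + g]. For [f] and [d] in [D] the
    form [a(u) K(f, d) du] has no residue at infinity, so by the residue theorem
    [Q(f, d)] is proportional to the value of [Qbar] on the evaluations
    ([Qform_ev2]). The kernel of the evaluation consists of the multiples of
    [(u^-1 - c1) (u^-1 - c2)], and the series orthogonal to it are those in [D]
    ([orthogonal_kernel]). Hence a Lagrangian subalgebra inside [D] contains the
    kernel, and taking images gives a bijection with the Lagrangian subalgebras of
    [g + g]. It respects transversality: [D] and [g[[u]]] span [g((u))], and the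
    elements [a + b u] of their intersection, with [a] of weights [0] and [-1] and [b] of
    weight [-1], are mapped bijectively onto [Delta_alpha] ([DeltaE],
    [ev2_taylor_surj], [ev2_taylor_inj]).

    Let [k > 1]. Then [- alpha] takes at [h] a value strictly between [-1] and [0], and
    for [x] in its root space [x u (u^-1 - c1) (u^-1 - c2)] is orthogonal to
    [O_alpha] without being in [O_alpha] ([no_lagrangian_in_order]). A Lagrangian [W]
    inside [O_alpha] would have to contain it. *)

(** * Linear spans *)

Section Subspaces.
Variables (F : fieldType) (U : lmodType F).
Implicit Types (W A : set U).

Lemma subspace0 W : is_subspace W -> W 0.
Proof. by case. Qed.

Lemma subspaceD W x y : is_subspace W -> W x -> W y -> W (x + y).
Proof. by move=> [_ WS] Wx Wy; rewrite -[x]scale1r; apply: WS. Qed.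

Lemma subspaceZ W a x : is_subspace W -> W x -> W (a *: x).
Proof. by move=> [W0 WS] Wx; rewrite -[_ *: _]addr0; apply: WS. Qed.

Lemma subspaceN W x : is_subspace W -> W x -> W (- x).
Proof. by move=> WS Wx; rewrite -scaleN1r; apply: subspaceZ. Qed.

Lemma subspaceB W x y : is_subspace W -> W x -> W y -> W (x - y).
Proof. by move=> WS Wx Wy; apply: subspaceD => //; apply: subspaceN. Qed.

Lemma subspace_sum W (I : eqType) (s : seq I) (f : I -> U) :
  is_subspace W -> (forall i, i \in s -> W (f i)) -> W (\sum_(i <- s) f i).
Proof.
move=> WS Wf; rewrite big_seq; elim/big_ind: _ => //; first by case: WS.
by move=> *; apply: subspaceD.
Qed.

Lemma lspan_is_subspace A : is_subspace (lspan A).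
Proof.
split=> [X [[]]//|a x y Ax Ay X [XS AX]].
by case: (XS) => _; apply; [apply: Ax | apply: Ay].
Qed.

Lemma sub_lspan A x : A x -> lspan A x.
Proof. by move=> Ax; apply: sub_gen_smallest. Qed.

Lemma lspan_ind A W : is_subspace W -> A `<=` W -> forall x, lspan A x -> W x.
Proof. by move=> WS AW; apply: smallest_sub. Qed.

Lemma lspan_mono A B : A `<=` lspan B -> lspan A `<=` lspan B.
Proof. by move=> AB; apply: lspan_ind => //; apply: lspan_is_subspace. Qed.

End Subspaces.

(** * Formal sums over the integers *)

Lemma fsum_int_seq (V : nmodType) (r : seq int) (f : int -> V) :
  uniq r -> (forall i, i \notin r -> f i = 0) ->
  \sum_(i \in [set: int]) f i = \sum_(i <- r) f i.
Proof.
move=> ur fr; rewrite (fsbigE r) //; last by move=> i _; apply: fr.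
by apply: eq_bigl => i; rewrite in_setT.
Qed.

Lemma fsum_int_shift (V : nmodType) (m : int) (f : int -> V) :
  \sum_(i \in [set: int]) f i = \sum_(i \in [set: int]) f (i - m).
Proof.
apply: (reindex_fsbigT (fun i => i - m)).
by exists (fun i => i + m) => i; rewrite ?subrK ?addrK.
Qed.

Lemma fsum_int_flip (V : nmodType) (m : int) (f : int -> V) :
  \sum_(i \in [set: int]) f i = \sum_(i \in [set: int]) f (m - i).
Proof.
apply: (reindex_fsbigT (fun i => m - i)).
by exists (fun i => m - i) => i; rewrite opprB addrC subrK.
Qed.

Lemma laurent_poly_support (V : nmodType) (f : int -> V) :
  @laurent_poly V f -> exists2 r, uniq r & forall i, i \notin r -> f i = 0.
Proof.
move=> [[N fN] [M fM]].
exists [seq N + k%:Z | k <- iota 0 `|M - N|%N.+1].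
  by rewrite map_inj_uniq ?iota_uniq // => a b /addrI [].
move=> i; have [/fN//|Ni] := ltP i N; have [/fM//|iM] := ltP M i.
case/negP; apply/mapP; exists `|i - N|%N; last by lia.
by rewrite mem_iota; lia.
Qed.

(** * Convolution *)

Section Laurent.
Variables (F : fieldType) (V : lmodType F).

Lemma laurent_is_subspace : is_subspace (@laurent V).
Proof.
split=> [|a f g [N fN] [M gM]]; first by exists 0.
exists (Order.min N M) => n; rewrite lt_min => /andP[nN nM].
by rewrite !fctE fN ?gM // scaler0 addr0.
Qed.

End Laurent.

Section Bilinear.
Variables (F : fieldType) (U V W : lmodType F) (op : U -> V -> W).
Hypotheses (op_linearl : forall y, linear (op^~ y))
           (op_linearr : forall x, linear (op x)).

Lemma bilinear0l y : op 0 y = 0.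
Proof. by have := op_linearl y (-1) 0 0; rewrite /= scaler0 addr0 scaleN1r addNr. Qed.

Lemma bilinear0r x : op x 0 = 0.
Proof. by have := op_linearr x (-1) 0 0; rewrite /= scaler0 addr0 scaleN1r addNr. Qed.

Lemma bilinearDl y x x' : op (x + x') y = op x y + op x' y.
Proof. by have := op_linearl y 1 x x'; rewrite /= !scale1r. Qed.

Lemma bilinearDr x y y' : op x (y + y') = op x y + op x y'.
Proof. by have := op_linearr x 1 y y'; rewrite /= !scale1r. Qed.

Lemma bilinearZl a x y : op (a *: x) y = a *: op x y.
Proof. by have := op_linearl y a x 0; rewrite /= bilinear0l !addr0. Qed.

Lemma bilinearZr a x y : op x (a *: y) = a *: op x y.
Proof. by have := op_linearr x a y 0; rewrite /= bilinear0r !addr0. Qed.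

Lemma bilinear_suml (I : Type) (r : seq I) (f : I -> U) y :
  op (\sum_(i <- r) f i) y = \sum_(i <- r) op (f i) y.
Proof. exact: (big_morph (op^~ y) (bilinearDl y) (bilinear0l y)). Qed.

Lemma bilinear_sumr (I : Type) (r : seq I) x (f : I -> V) :
  op x (\sum_(i <- r) f i) = \sum_(i <- r) op x (f i).
Proof. exact: (big_morph (op x) (bilinearDr x) (bilinear0r x)). Qed.

Lemma conv_laurent f h :
  @laurent U f -> @laurent V h -> @laurent W (conv op f h).
Proof.
move=> [N fN] [M hM]; exists (N + M) => n nNM.
apply: fsbig1 => i _; have [iN|Ni] := ltP i N.
  by rewrite fN // bilinear0l.
by rewrite hM ?bilinear0r //; lia.
Qed.

Lemma conv_laurent_inv f h :
  @laurent_inv U f -> @laurent_inv V h -> @laurent_inv W (conv op f h).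
Proof.
move=> [N fN] [M hM]; exists (N + M) => n nNM.
apply: fsbig1 => i _; have [iN|Ni] := ltP N i.
  by rewrite fN // bilinear0l.
by rewrite hM ?bilinear0r //; lia.
Qed.

Lemma conv_laurent_poly f h :
  @laurent_poly U f -> @laurent_poly V h -> @laurent_poly W (conv op f h).
Proof.
move=> [f1 f2] [h1 h2].
by split; [apply: conv_laurent | apply: conv_laurent_inv].
Qed.

End Bilinear.

(** * Evaluation of Laurent polynomials *)

(** The value at [u = c^-1] of a Laurent polynomial in [u]. *)
Definition ev (F : fieldType) (V : lmodType F) (c : F) (f : int -> V) : V :=
  \sum_(n \in [set: int]) c ^ (- n) *: f n.

Lemma ev_seq (F : fieldType) (V : lmodType F) (c : F) (f : int -> V) r :
  uniq r -> (forall i, i \notin r -> f i = 0) ->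
  ev c f = \sum_(i <- r) c ^ (- i) *: f i.
Proof. by move=> ur fr; apply: fsum_int_seq => // i /fr ->; rewrite scaler0. Qed.

Lemma ev_linear (F : fieldType) (V : lmodType F) (c a : F) (f h : int -> V) :
  @laurent_poly V f -> @laurent_poly V h ->
  ev c (a *: f + h) = a *: ev c f + ev c h.
Proof.
move=> /laurent_poly_support[r ur fr] /laurent_poly_support[s us hs].
have rs i : i \notin undup (r ++ s) -> f i = 0 /\ h i = 0.
  by rewrite mem_undup mem_cat negb_or => /andP[/fr -> /hs ->].
have evE k : (forall i, i \notin undup (r ++ s) -> k i = 0) ->
    ev c k = \sum_(i <- undup (r ++ s)) c ^ (- i) *: k i.
  by apply: ev_seq; rewrite undup_uniq.
rewrite !evE; try by move=> i /rs[].
2: by move=> i /rs[fi hi]; rewrite !fctE fi hi scaler0 addr0.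
rewrite scaler_sumr -big_split; apply: eq_bigr => i _.
by rewrite !fctE scalerDr !scalerA mulrC.
Qed.

Lemma ev_conv (F : fieldType) (U V W : lmodType F) (op : U -> V -> W)
    (op_linearl : forall y, linear (op^~ y)) (op_linearr : forall x, linear (op x))
    (c : F) (c_neq0 : c != 0) (f : int -> U) (h : int -> V) :
  @laurent_poly U f -> @laurent_poly V h ->
  ev c (conv op f h) = op (ev c f) (ev c h).
Proof.
move=> fP hP; have [r ur fr] := laurent_poly_support fP.
have [s us hs] := laurent_poly_support hP.
have [t ut tP] := laurent_poly_support (conv_laurent_poly op_linearl op_linearr fP hP).
pose T := undup (t ++ [seq i + j | i <- r, j <- s]).
rewrite (@ev_seq _ _ _ _ T) ?undup_uniq //; last first.
  by move=> i; rewrite mem_undup mem_cat negb_or => /andP[/tP].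
rewrite [ev c f](ev_seq _ ur fr) (bilinear_suml op_linearl).
transitivity (\sum_(n <- T) \sum_(i <- r) c ^ (- n) *: op (f i) (h (n - i))).
  apply: eq_bigr => n _; rewrite -scaler_sumr; congr (_ *: _).
  by apply: fsum_int_seq => // i /fr ->; rewrite (bilinear0l op_linearl).
rewrite exchange_big; apply: eq_big_seq => i ir /=.
rewrite (bilinearZl op_linearl).
transitivity (c ^ (- i) *: op (f i) (\sum_(n <- T) c ^ (- (n - i)) *: h (n - i))).
  rewrite (bilinear_sumr op_linearr) scaler_sumr; apply: eq_bigr => n _.
  rewrite (bilinearZr op_linearr) scalerA -expfzDr //; congr (_ ^ _ *: _); lia.
congr (_ *: op _ _); rewrite /ev (fsum_int_shift i).
rewrite (@fsum_int_seq _ T) ?undup_uniq // => n nT.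
rewrite hs ?scaler0 //; apply: contra nT => nis.
rewrite mem_undup mem_cat; apply/orP; right; apply/allpairsP.
by exists (i, n - i); split=> //=; rewrite addrC subrK.
Qed.

(** * The residue pairing *)

Lemma conv_flip (A B C : nmodType) (op : A -> B -> C) f h :
  conv op f h = conv (fun b a => op a b) h f.
Proof.
apply/funext => n; rewrite /conv (fsum_int_flip n).
by apply: eq_fsbigr => i _; rewrite subKr.
Qed.

Section Residue.
Variables (F : fieldType) (c1 c2 : F).
Implicit Types (t phi : int -> F).

Lemma a_series_partial_fractions (i : int) :
  (c1 - c2) * a_series c1 c2 i =
  if i is Posz m then c1 ^+ m.+1 - c2 ^+ m.+1 else 0.
Proof.
rewrite /a_series /conv; case: i => m; last first.
  rewrite fsbig1 ?mulr0 // => -[] j _; last by rewrite /= mul0r.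
  rewrite /= (_ : Negz m - Posz j = Negz (m + j)%N) ?mulr0 //; lia.
rewrite (@fsum_int_seq _ [seq Posz j | j <- iota 0 m.+1]); last first.
- move=> [] j jm; last by rewrite /= mul0r.
  have mj : (m < j)%N.
    rewrite ltnNge; apply: contra jm => jm; apply: map_f.
    by rewrite mem_iota.
  by rewrite (_ : Posz m - Posz j = Negz (j - m.+1)%N) /= ?mulr0 //; lia.
- by rewrite map_inj_uniq ?iota_uniq // => a b [].
rewrite big_map -[iota _ _]/(index_iota 0 m.+1) big_mkord.
rewrite -[LHS]opprK -mulNr opprB -[RHS]opprB subrXX; congr (- (_ * _)).
apply: eq_bigr => j _.
have jm : (j <= m)%N by rewrite -ltnS.
by rewrite (_ : Posz m - Posz j = Posz (m - j)%N) /= 1?mulrC //; lia.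
Qed.

Lemma residue_a_series t (M : nat) :
  (forall n : int, n < - M%:Z -> t n = 0) ->
  (c1 - c2) * residue (conv *%R (a_series c1 c2) t) =
  \sum_(i < M) (c1 ^+ i.+1 - c2 ^+ i.+1) * t (- 1 - i%:Z).
Proof.
move=> tM; rewrite /residue /conv mulr_fsumr.
rewrite (@fsum_int_seq _ [seq Posz j | j <- iota 0 M]); last first.
- move=> [] j jM; rewrite mulrA a_series_partial_fractions ?mul0r //.
  have Mj : (M <= j)%N.
    rewrite leqNgt; apply: contra jM => jM; apply: map_f.
    by rewrite mem_iota.
  by rewrite tM ?mulr0 //; lia.
- by rewrite map_inj_uniq ?iota_uniq // => a b [].
rewrite big_map (_ : iota 0 M = index_iota 0 M) ?big_mkord; last first.
  by rewrite /index_iota subn0.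
by apply: eq_bigr => i _; rewrite mulrA a_series_partial_fractions.
Qed.

(** The residue theorem: for [t] a polynomial in [u^-1] the form [a(u) t(u) du]
    has no residue at infinity, because [a] vanishes there to order two; so its
    residue at [0] is minus the sum of the residues at the poles [c1^-1] and
    [c2^-1] of [a], where [a] has residues [- (c1 - c2)^-1] and [(c1 - c2)^-1]. *)
Lemma residue_nonpositive t :
  @laurent F t -> (forall n : int, 0 < n -> t n = 0) ->
  (c1 - c2) * residue (conv *%R (a_series c1 c2) t) =
  ev c1 (t : int -> F^o) - ev c2 (t : int -> F^o).
Proof.
move=> [N tN] t_gt0.
have tM (n : int) : n < - `|N|%N%:Z -> t n = 0 by move=> nN; apply: tN; lia.
rewrite (residue_a_series tM); set M := `|N|%N in tM *.
pose r := 0%:Z :: [seq - 1 - i%:Z | i <- iota 0 M].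
have ur : uniq r.
  rewrite /= map_inj_uniq ?iota_uniq ?andbT => [|a b]; last by lia.
  by apply/mapP => -[i _]; lia.
have tr n : n \notin r -> t n = 0.
  have [/t_gt0 -> // | n0] := ltP 0 n; have [/tM -> // | Mn] := ltP n (- M%:Z).
  rewrite in_cons negb_or => /andP[n_neq0 /mapP[]].
  by exists (absz (n + 1)); rewrite ?mem_iota; lia.
rewrite !(@ev_seq F F^o _ t r ur tr) !big_cons !big_map oppr0 !expr0z.
rewrite opprD addrACA addrN add0r.
rewrite -sumrB (_ : iota 0 M = index_iota 0 M) ?big_mkord; last first.
  by rewrite /index_iota subn0.
apply: eq_bigr => i _; rewrite -scalerBl; congr (_ * _).
by rewrite (_ : - (- 1 - i%:Z) = Posz i.+1) //; lia.
Qed.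

Lemma telescope_geometric (a b : F) (phi : int -> F) (M : nat) :
  phi (- 1 - M%:Z) = 0 -> phi (- 2 - M%:Z) = 0 ->
  \sum_(i < M) a ^+ i.+1 *
     (phi (- 1 - i%:Z) - (a + b) * phi (- 1 - i%:Z - 1) + a * b * phi (- 1 - i%:Z - 2)) =
  a * (phi (- 1) - b * phi (- 2)).
Proof.
move=> phi1 phi2.
pose T (i : nat) := a ^+ i.+1 * (b * phi (- 2 - i%:Z) - phi (- 1 - i%:Z)).
transitivity (\sum_(i < M) (T i.+1 - T i)).
  apply: eq_bigr => i _; rewrite /T.
  rewrite (_ : - 1 - i%:Z - 1 = - 2 - i%:Z); last by lia.
  rewrite (_ : - 1 - i%:Z - 2 = - 2 - i.+1%:Z); last by lia.
  rewrite (_ : - 1 - i.+1%:Z = - 2 - i%:Z); last by lia.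
  by rewrite [a ^+ i.+2]exprS; move: (a ^+ i.+1) => p; ring.
rewrite -(big_mkord xpredT (fun i => T i.+1 - T i)) telescope_sumr // /T.
by rewrite phi1 phi2 !subr0 expr1; ring.
Qed.

Hypothesis c1_neq_c2 : c1 != c2.

(** Here [t(u) = (1 - c1 u) (1 - c2 u) phi(u)], so [a(u) t(u) = phi(u)]. After the
    splitting of [a] into two geometric series both sums telescope. *)
Lemma residue_two_factors t phi :
  @laurent F phi ->
  (forall n, t n = phi n - (c1 + c2) * phi (n - 1) + c1 * c2 * phi (n - 2)) ->
  residue (conv *%R (a_series c1 c2) t) = phi (- 1).
Proof.
move=> [N phiN] tE; apply: (@mulfI F (c1 - c2)); first by rewrite subr_eq0.
have phiM (n : int) : n < - `|N|%N%:Z -> phi n = 0 :> F.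
  by move=> nN; apply: phiN; lia.
set M := `|N|%N in phiM *.
rewrite (@residue_a_series t M.+2); last first.
  by move=> n nM; rewrite tE !phiM ?mulr0 ?subrr ?addr0 //; lia.
have phi1 : phi (- 1 - M.+2%:Z) = 0 by apply: phiM; lia.
have phi2 : phi (- 2 - M.+2%:Z) = 0 by apply: phiM; lia.
have tE1 i : (c1 ^+ i.+1 - c2 ^+ i.+1) * t (- 1 - i%:Z) =
    c1 ^+ i.+1 * (phi (- 1 - i%:Z) - (c1 + c2) * phi (- 1 - i%:Z - 1) +
                  c1 * c2 * phi (- 1 - i%:Z - 2)) -
    c2 ^+ i.+1 * (phi (- 1 - i%:Z) - (c2 + c1) * phi (- 1 - i%:Z - 1) +
                  c2 * c1 * phi (- 1 - i%:Z - 2)).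
  by rewrite tE mulrBl [c2 + c1]addrC [c2 * c1]mulrC.
under eq_bigr do rewrite tE1.
rewrite sumrB (telescope_geometric c1 c2 phi1 phi2) (telescope_geometric c2 c1 phi1 phi2).
move: (phi (- 1)) (phi (- 2)) => x y.
by rewrite !mulrBr mulrBl !mulrA [c2 * c1]mulrC opprB addrA subrK.
Qed.

End Residue.

Definition monomial (V : nmodType) (n : int) (x : V) : int -> V :=
  fun i => if i == n then x else 0.

Lemma ev_monomial (F : fieldType) (V : lmodType F) (c : F) n (x : V) :
  ev c (monomial n x) = c ^ (- n) *: x.
Proof.
rewrite (@ev_seq _ _ _ _ [:: n]) ?big_seq1 /monomial ?eqxx // => i.
by rewrite inE => /negPf ->.
Qed.

(** The polynomial [y u^s (u^-1 - c1) (u^-1 - c2)], which vanishes at both poles of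
    [a(u)]. *)
Definition two_zeros (F : fieldType) (V : lmodType F) (c1 c2 : F) (s : int) (y : V) :
    int -> V :=
  fun i => if i == s then (c1 * c2) *: y else if i == s - 1 then - (c1 + c2) *: y
           else if i == s - 2 then y else 0.

Section TwoZeros.
Variables (F : fieldType) (V : lmodType F) (c1 c2 : F) (s : int) (y : V).

Let r := [:: s; s - 1; s - 2].

Let ur : uniq r.
Proof. by rewrite /= !inE; lia. Qed.

Let two_zeros_out i : i \notin r -> two_zeros c1 c2 s y i = 0.
Proof. by rewrite !inE /two_zeros; do 3![case: eqP => //]. Qed.

Let two_zeros_r : (two_zeros c1 c2 s y s = (c1 * c2) *: y) *
  (two_zeros c1 c2 s y (s - 1) = - (c1 + c2) *: y) *
  (two_zeros c1 c2 s y (s - 2) = y).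
Proof.
have e1 : (s - 1 == s) = false by apply/eqP; lia.
have e2 : (s - 2 == s) = false by apply/eqP; lia.
have e3 : (s - 2 == s - 1) = false by apply/eqP; lia.
by rewrite /two_zeros !eqxx e1 e2 e3.
Qed.

Lemma two_zeros_laurent_poly : @laurent_poly V (two_zeros c1 c2 s y).
Proof.
split; [exists (s - 2)|exists s] => n ns;
  by apply: two_zeros_out; rewrite !inE; lia.
Qed.

Lemma ev_two_zeros c : c != 0 -> (c - c1) * (c - c2) = 0 ->
  ev c (two_zeros c1 c2 s y) = 0.
Proof.
move=> c0 cc; rewrite (ev_seq _ ur two_zeros_out) !big_cons big_nil !two_zeros_r.
rewrite addr0 !scalerA -!scalerDl.
rewrite !opprB !expfzDr // expr1z.
have factor (q : F) :
    q * (c1 * c2) + (c * q * - (c1 + c2) + c * c * q) = q * ((c - c1) * (c - c2)).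
  by ring.
transitivity ((c ^ (- s) * ((c - c1) * (c - c2))) *: y).
  by rewrite -factor.
by rewrite cc mulr0 scale0r.
Qed.

Lemma conv_two_zeros (U : lmodType F) (W : lmodType F) (op : U -> V -> W) f n :
  (forall x, linear (op x)) ->
  conv op f (two_zeros c1 c2 s y) n =
  (c1 * c2) *: op (f (n - s)) y - (c1 + c2) *: op (f (n - (s - 1))) y +
  op (f (n - (s - 2))) y.
Proof.
move=> op_linear; rewrite conv_flip /conv (@fsum_int_seq _ r) //; last first.
  by move=> i /two_zeros_out ->; apply: (bilinear0r op_linear).
rewrite !big_cons big_nil addr0 !two_zeros_r !(bilinearZr op_linear).
by rewrite scaleNr addrA.
Qed.

End TwoZeros.

(** * Polynomials of an endomorphism *)

Lemma linear_lfun (F : fieldType) (aT rT : vectType F) (f : aT -> rT) :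
  linear f -> exists phi : 'Hom(aT, rT), phi =1 f.
Proof.
move=> f_linear.
exists (linfun (HB.pack_for {linear aT -> rT} f
  (GRing.isLinear.Build F aT rT _ f f_linear))).
by move=> x; rewrite lfunE.
Qed.

Section PolynomialAction.
Variables (F : fieldType) (V : vectType F) (T : 'End(V)).
Implicit Types (p q : {poly F}) (v : V).

Definition poly_act p v : V := \sum_(i < size p) p`_i *: iter i T v.

Lemma poly_act_wide n p v :
  (size p <= n)%N -> poly_act p v = \sum_(i < n) p`_i *: iter i T v.
Proof.
move=> pn; rewrite /poly_act (big_ord_widen n (fun i => p`_i *: iter i T v) pn).
rewrite big_mkcond; apply: eq_bigr => i _; case: ltnP => // /(nth_default 0) ->.
by rewrite scale0r.
Qed.

Lemma poly_act_linear p : linear (poly_act p).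
Proof.
have iter_linear i : linear (iter i T).
  by elim: i => [|i IH] a u v //=; rewrite IH linearP.
move=> a u v; rewrite /poly_act scaler_sumr -big_split; apply: eq_bigr => i _.
by rewrite iter_linear scalerDr !scalerA mulrC.
Qed.
HB.instance Definition _ p := GRing.isLinear.Build F V V _ (poly_act p) (poly_act_linear p).

Lemma poly_act0p v : poly_act 0 v = 0.
Proof. by rewrite /poly_act size_poly0 big_ord0. Qed.

Lemma poly_actD p q v : poly_act (p + q) v = poly_act p v + poly_act q v.
Proof.
pose n := maxn (size p) (size q).
rewrite !(@poly_act_wide n) ?leq_maxl ?leq_maxr ?(leq_trans (size_polyD _ _)) //.
by rewrite -big_split; apply: eq_bigr => i _; rewrite coefD scalerDl.
Qed.

Lemma poly_act_sum (I : Type) (s : seq I) (P : I -> {poly F}) v :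
  poly_act (\sum_(i <- s) P i) v = \sum_(i <- s) poly_act (P i) v.
Proof. exact: (big_morph (poly_act^~ v) (fun p q => poly_actD p q v) (poly_act0p v)). Qed.

Lemma poly_actZ a p v : poly_act (a *: p) v = a *: poly_act p v.
Proof.
rewrite (@poly_act_wide (size p)) ?size_scale_leq // scaler_sumr.
by apply: eq_bigr => i _; rewrite coefZ scalerA.
Qed.

Lemma poly_actC c v : poly_act c%:P v = c *: v.
Proof. by rewrite (poly_act_wide _ (size_polyC_leq1 c)) big_ord1 coefC. Qed.

Lemma poly_act1 v : poly_act 1 v = v.
Proof. by rewrite poly_actC scale1r. Qed.

Lemma poly_actMX p v : poly_act (p * 'X) v = T (poly_act p v).
Proof.
rewrite (@poly_act_wide (size p).+1); last first.
  by rewrite (leq_trans (size_polyMleq _ _)) // size_polyX addn2.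
rewrite big_ord_recl coefMX scale0r add0r linear_sum; apply: eq_bigr => i _.
by rewrite coefMX linearZ.
Qed.

Lemma poly_actX v : poly_act 'X v = T v.
Proof. by rewrite -['X]mul1r poly_actMX poly_act1. Qed.

Lemma poly_actM p q v : poly_act (p * q) v = poly_act p (poly_act q v).
Proof.
elim/poly_ind: p => [|p c IH]; first by rewrite mul0r !poly_act0p.
rewrite mulrDl !poly_actD mul_polyC poly_actZ poly_actC; congr (_ + _).
by rewrite mulrAC !poly_actMX IH.
Qed.

Lemma poly_act_dvd p q v : p %| q -> poly_act p v = 0 -> poly_act q v = 0.
Proof. by move=> /dvdpP[s ->] pv; rewrite poly_actM pv linear0. Qed.

Lemma poly_act_coprime p q v :
  coprimep p q -> poly_act p v = 0 -> poly_act q v = 0 -> v = 0.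
Proof.
move=> /Bezout_eq1_coprimepP[[a b] /= ab] pv qv.
by rewrite -[v]poly_act1 -ab poly_actD !poly_actM pv qv !linear0 addr0.
Qed.

Lemma poly_act_comm (f : {linear V -> V}) p v :
  (forall w, f (T w) = T (f w)) -> f (poly_act p v) = poly_act p (f v).
Proof.
move=> fT; rewrite linear_sum; apply: eq_bigr => i _; rewrite linearZ /=.
by congr (_ *: _); elim: (i : nat) => //= k <-.
Qed.

End PolynomialAction.

Lemma Cayley_Hamilton_row (F : fieldType) n (A : 'M[F]_n) (u : 'rV_n) :
  \sum_(i < size (char_poly A)) (char_poly A)`_i *: iter i (mulmxr A) u = 0.
Proof.
case: n => [|n] in A u *; first by rewrite [LHS]thinmx0.
have := congr1 (mulmx u) (Cayley_Hamilton A).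
rewrite mulmx0 -{1}[char_poly A]coefK poly_def linear_sum mulmx_sumr => CH.
rewrite -[RHS]CH.
apply: eq_bigr => i _; rewrite linearZ /= -scalemxAr; congr (_ *: _).
rewrite rmorphXn /= horner_mx_X; elim: (i : nat) => [|k IH] /=.
  by rewrite expr0 mulmx1.
by rewrite exprSr mulmxA -IH.
Qed.

Section Annihilating.
Import VectorInternalTheory.

Lemma annihilating_poly (F : fieldType) (V : vectType F) (T : 'End(V)) :
  exists2 p : {poly F}, p != 0 & forall v, poly_act T p v = 0.
Proof.
exists (char_poly (f2mx T)).
  exact/monic_neq0/char_poly_monic.
move=> v; apply: v2r_inj.
rewrite linear0 -[RHS](Cayley_Hamilton_row (f2mx T) (v2r v)) linear_sum.
apply: eq_bigr => i _; rewrite linearZ; congr (_ *: _).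
elim: (i : nat) => //= k <-.
by rewrite unlock /= r2vK.
Qed.

End Annihilating.

(** * Primary decomposition *)

(** The Chinese remainder theorem for the pairwise coprime [('X - a%:P) ^+ N]: when
    [P] annihilates an endomorphism, the [E a] act as the projections on its
    generalized eigenspaces. *)
Lemma primary_idempotents (F : fieldType) (N : nat) (s : seq F) :
  uniq s ->
  let P := \prod_(a <- s) ('X - a%:P) ^+ N in
  exists E : F -> {poly F},
    P %| (\sum_(a <- s) E a - 1) /\
    forall a, a \in s -> P %| ('X - a%:P) ^+ N * E a.
Proof.
elim: s => [|a s IH] /=.
  by move=> _; exists (fun=> 0); rewrite !big_nil dvd1p; split.
move=> /andP[a_s us]; have [E [EP1 EP]] := IH us.
pose q := ('X - a%:P) ^+ N; pose P := \prod_(b <- s) ('X - b%:P) ^+ N.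
have /Bezout_eq1_coprimepP[[u v] /= uv] : coprimep q P.
  apply: coprimep_expl; rewrite /P coprimep_sym big_seq.
  elim/big_ind: _ => [|f h f1 h1|b bs]; first exact: coprime1p.
    by rewrite coprimepMl f1.
  apply: coprimep_expl; apply: coprimep_XsubC2; rewrite subr_eq0.
  by apply: contraNneq a_s => ->.
(* From [u * q + v * P = 1], the factor [u * q] is [1] modulo [P] and [0] modulo [q]. *)
exists (fun b => if b == a then v * P else u * q * E b); rewrite !big_cons eqxx.
rewrite -/q -/P; split=> [|b].
  have -> : \sum_(b <- s) (if b == a then v * P else u * q * E b) =
      u * q * \sum_(b <- s) E b.
    rewrite mulr_sumr; apply: eq_big_seq => b bs.
    by rewrite ifN //; apply: contraNneq a_s => <-.
  have -> : v * P + u * q * (\sum_(b <- s) E b) - 1 =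
      u * (q * (\sum_(b <- s) E b - 1)) by rewrite -(addKr (u * q) (v * P)) uv; ring.
  by apply: dvdp_mull; apply: dvdp_mul.
rewrite inE; case: eqVneq => [-> _|_ /= bs].
  by rewrite -/q mulrCA dvdp_mull.
rewrite [X in _ %| X](_ : _ = u * (q * (('X - b%:P) ^+ N * E b))); last by ring.
by apply: dvdp_mull; apply: dvdp_mul => //; apply: EP.
Qed.

Definition gen_eigen (F : fieldType) (V : vectType F) (T : 'End(V)) (a : F) : set V :=
  [set v | exists n, poly_act T (('X - a%:P) ^+ n) v = 0].

Lemma gen_eigen_disjoint (F : fieldType) (V : vectType F) (T : 'End(V)) a b v :
  a != b -> gen_eigen T a v -> gen_eigen T b v -> v = 0.
Proof.
move=> ab [m am] [n bn]; apply: poly_act_coprime am bn.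
apply: coprimep_expl; apply: coprimep_expr; apply: coprimep_XsubC2.
by rewrite subr_eq0 eq_sym.
Qed.

(** The projections are polynomials in [T], so they commute with whatever commutes
    with [T]. *)
Lemma primary_decomposition (F : closedFieldType) (V : vectType F) (T : 'End(V)) :
  exists (s : seq F) (E : F -> {poly F}),
    [/\ uniq s, forall v, v = \sum_(a <- s) poly_act T (E a) v &
        forall a v, a \in s -> gen_eigen T a (poly_act T (E a) v)].
Proof.
have [p p0 pT] := annihilating_poly T.
have [rs p_rs] := closed_field_poly_normal p.
have [E [EP1 EP]] := primary_idempotents (size rs) (undup_uniq rs).
set P := \prod_(_ <- _) _ in EP1 EP.
have PT v : poly_act T P v = 0.
  apply: poly_act_dvd (pT v); rewrite p_rs dvdpZl ?lead_coef_eq0 //.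
  rewrite -prodr_undup_exp_count /P !big_seq.
  elim/big_ind2: _ => // [f1 f2 h1 h2|a _]; first exact: dvdp_mul.
  by apply: dvdp_exp2l; apply: count_size.
exists (undup rs), E; split=> [|v|a v ar]; first exact: undup_uniq.
  apply/eqP; rewrite eq_sym -subr_eq0 -poly_act_sum -{2}[v](poly_act1 T).
  rewrite -scaleN1r -poly_actZ.
  by rewrite -poly_actD scaleN1r; apply/eqP; apply: poly_act_dvd (PT v).
by exists (size rs); rewrite -poly_actM; apply: poly_act_dvd (PT v); apply: EP.
Qed.

(** * The Killing form *)

Section Killing.
Variables (F : fieldType) (g : vectType F) (L : lie_algebra g).
Implicit Types (x y z : g).
Local Notation "[% x , y ]" := (lie_br L x y).

Lemma lie_br_linearr x : linear (lie_br L x).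
Proof. by move=> a y z; rewrite /lie_br linearP. Qed.

Lemma lie_br_linearl y : linear ((lie_br L)^~ y).
Proof. by move=> a x z; rewrite /lie_br linearP add_lfunE scale_lfunE. Qed.

Lemma lie_br0l x : [% 0, x] = 0.
Proof. exact: (bilinear0l lie_br_linearl). Qed.

Lemma lie_br0r x : [% x, 0] = 0.
Proof. exact: (bilinear0r lie_br_linearr). Qed.

Lemma lie_brZl a x y : [% a *: x, y] = a *: [% x, y].
Proof. exact: (bilinearZl lie_br_linearl). Qed.

Lemma lie_brZr a x y : [% x, a *: y] = a *: [% x, y].
Proof. exact: (bilinearZr lie_br_linearr). Qed.

Lemma lie_brC x y : [% x, y] = - [% y, x].
Proof.
have br0 z : [% z, z] = 0 by apply: lie_alternating.
have := br0 (x + y); rewrite (bilinearDl lie_br_linearl).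
rewrite !(bilinearDr lie_br_linearr) !br0 add0r addr0.
by move/eqP; rewrite addr_eq0 => /eqP.
Qed.

Lemma lie_brNr x y : [% x, - y] = - [% x, y].
Proof. by rewrite -scaleN1r lie_brZr scaleN1r. Qed.

Lemma lie_brBr x y z : [% x, y - z] = [% x, y] - [% x, z].
Proof. by rewrite (bilinearDr lie_br_linearr) lie_brNr. Qed.

Lemma lie_brBl x y z : [% x - y, z] = [% x, z] - [% y, z].
Proof. by rewrite [LHS]lie_brC lie_brBr opprB ![lie_br L _ z]lie_brC opprK addrC. Qed.

Lemma lie_br_derivation x y z : [% x, [% y, z]] = [% [% x, y], z] + [% y, [% x, z]].
Proof.
have /eqP : [% x, [% y, z]] + [% y, [% z, x]] + [% z, [% x, y]] = 0.
  exact: lie_jacobi.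
rewrite -addrA addr_eq0 => /eqP ->; rewrite opprD addrC.
by rewrite -lie_brC -lie_brNr -lie_brC.
Qed.

Lemma lie_ad_br x y :
  lie_ad L [% x, y] = ((lie_ad L x \o lie_ad L y) - (lie_ad L y \o lie_ad L x))%VF.
Proof.
apply/lfunP => z; rewrite add_lfunE opp_lfunE !comp_lfunE.
by apply/eqP; rewrite eq_sym subr_eq; apply/eqP/lie_br_derivation.
Qed.

Lemma lfun_trace_linear : linear (@lfun_trace F g : 'End(g) -> F^o).
Proof. by move=> a f h; rewrite /lfun_trace passmx.mxof_linear linearP. Qed.

Lemma lfun_traceB (f h : 'End(g)) : lfun_trace (f - h) = lfun_trace f - lfun_trace h.
Proof.
by rewrite addrC -scaleN1r lfun_trace_linear scaleN1r addrC.
Qed.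

Lemma lfun_traceC (f h : 'End(g)) : lfun_trace (f \o h)%VF = lfun_trace (h \o f)%VF.
Proof.
by rewrite /lfun_trace !(passmx.mxof_comp _ _ (vbasisP {:g})) mxtrace_mulC.
Qed.

Lemma killing_linearr x : linear (killing L x : g -> F^o).
Proof.
move=> a y z; rewrite /killing linearP /= comp_lfunDr -comp_lfunZr.
exact: lfun_trace_linear.
Qed.

Lemma killingC x y : killing L x y = killing L y x.
Proof. exact: lfun_traceC. Qed.

Lemma killing_linearl y : linear ((killing L)^~ y : g -> F^o).
Proof. by move=> a x z; rewrite ![killing _ _ y]killingC killing_linearr. Qed.

Lemma killing0l x : killing L 0 x = 0.
Proof. exact: (bilinear0l killing_linearl). Qed.

Lemma killing0r x : killing L x 0 = 0.
Proof. exact: (bilinear0r killing_linearr). Qed.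

Lemma killingZl a x y : killing L (a *: x) y = a * killing L x y.
Proof. exact: (bilinearZl killing_linearl). Qed.

Lemma killingZr a x y : killing L x (a *: y) = a * killing L x y.
Proof. exact: (bilinearZr killing_linearr). Qed.

Lemma killing_invariant x y z : killing L [% x, y] z = killing L x [% y, z].
Proof.
rewrite /killing !lie_ad_br comp_lfunDl comp_lfunNl comp_lfunDr comp_lfunNr.
rewrite !lfun_traceB !comp_lfunA; congr (_ - _).
transitivity (lfun_trace (lie_ad L y \o (lie_ad L x \o lie_ad L z))%VF).
  by rewrite comp_lfunA.
exact: lfun_traceC.
Qed.

Lemma killing_skew t x y : killing L [% t, x] y = - killing L x [% t, y].
Proof.
by rewrite lie_brC -scaleN1r killingZl mulN1r killing_invariant.
Qed.

End Killing.

Section Nondegenerate.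
Variables (F : fieldType) (g : vectType F) (L : lie_algebra g).
Implicit Types (x y z : g).
Local Notation "[% x , y ]" := (lie_br L x y).

Definition killing_nondegenerate : Prop :=
  forall x, (forall y, killing L x y = 0) -> x = 0.

Definition killing_fun x : 'Hom(g, F^o) :=
  linfun (HB.pack_for {linear g -> F^o} (killing L x : g -> F^o)
    (GRing.isLinear.Build F g F^o _ (killing L x : g -> F^o) (killing_linearr L x))).

Lemma killing_funE x y : killing_fun x y = killing L x y.
Proof. by rewrite lfunE. Qed.

Lemma killing_fun_linear : linear killing_fun.
Proof.
move=> a x y; apply/lfunP => z; rewrite add_lfunE scale_lfunE !killing_funE.
exact: killing_linearl.
Qed.
HB.instance Definition _ :=
  GRing.isLinear.Build F g 'Hom(g, F^o) _ killing_fun killing_fun_linear.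

(** The radical of the Killing form is an ideal. *)
Lemma simple_killing : is_simple L ->
  killing_nondegenerate \/ forall x y, killing L x y = 0.
Proof.
move=> [_ simpleL].
have radP x : x \in lker (linfun killing_fun) <-> forall y, killing L x y = 0.
  rewrite memv_ker lfunE /=; split=> [/eqP kx y|kx].
    by rewrite -killing_funE kx zero_lfunE.
  by apply/eqP/lfunP => y; rewrite killing_funE zero_lfunE kx.
have /simpleL[rad0|radT] : is_ideal L (lker (linfun killing_fun)).
- move=> x y /radP ky; apply/radP => z.
  by rewrite killing_skew ky oppr0.
- by left=> x /radP; rewrite rad0 memv0 => /eqP.
- by right=> x; apply/radP; rewrite radT memvf.
Qed.

Lemma killing_representation (f : 'Hom(g, F^o)) : killing_nondegenerate ->
  exists d, forall x, killing L d x = f x.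
Proof.
move=> ndeg; set k := linfun killing_fun.
have k_inj : (fullv :&: lker k = 0)%VS.
  apply/eqP; rewrite -subv0; apply/subvP => x; rewrite memv_cap memv_ker lfunE /=.
  move=> /andP[_ /eqP kx]; rewrite memv0; apply/eqP/ndeg => y.
  by rewrite -killing_funE kx zero_lfunE.
have k_surj : limg k = fullv.
  apply/eqP; rewrite eqEdim subvf (limg_dim_eq k_inj) !dimvf.
  by apply: eq_leq; apply: (muln1 (dim g)).
have /memv_imgP[d _ fd] : f \in limg k by rewrite k_surj memvf.
by exists d => x; rewrite -killing_funE fd /k [linfun _ d]lfunE.
Qed.

(** The functional [x |-> tr (D o ad x)] is [K d] for some [d], so that
    [E = D - ad d] is a derivation with [tr (E o ad x) = 0] for all [x]; then
    [K (E x) y = tr ([E, ad x] o ad y) = tr (E o ad [x, y]) = 0]. *)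
Lemma derivation_inner (D : 'End(g)) : killing_nondegenerate ->
  (forall x y, D [% x, y] = [% D x, y] + [% x, D y]) ->
  exists d, forall x, D x = [% d, x].
Proof.
move=> ndeg Dder.
have tr_linear : linear (fun x => lfun_trace (D \o lie_ad L x)%VF : F^o).
  by move=> a x y; rewrite linearP comp_lfunDr -comp_lfunZr; apply: lfun_trace_linear.
have [f fE] := linear_lfun tr_linear.
have [d dP] := killing_representation f ndeg.
exists d => x; apply/eqP; rewrite -subr_eq0; apply/eqP.
have [E [EE trE] ] : exists E : 'End(g), (forall z, E z = D z - [% d, z]) /\
    forall z, lfun_trace (E \o lie_ad L z)%VF = 0.
  exists (D - lie_ad L d); split=> z; first by rewrite add_lfunE opp_lfunE.
  rewrite comp_lfunDl comp_lfunNl lfun_traceB.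
  by apply/eqP; rewrite subr_eq0; apply/eqP; rewrite -[RHS]/(killing L d z) dP fE.
rewrite -EE; apply: ndeg => y.
have adE : lie_ad L (E x) = ((E \o lie_ad L x) - (lie_ad L x \o E))%VF.
  apply/lfunP => z; rewrite add_lfunE opp_lfunE !comp_lfunE.
  rewrite -![lie_ad L _ _]/(lie_br L _ _) !EE Dder lie_br_derivation.
  by rewrite lie_brBl lie_brBr opprD addrACA addrK.
rewrite /killing adE comp_lfunDl comp_lfunNl lfun_traceB.
apply/eqP; rewrite subr_eq0 -!comp_lfunA; apply/eqP.
rewrite [RHS]lfun_traceC -comp_lfunA.
apply/eqP; rewrite -subr_eq0 -lfun_traceB; apply/eqP.
by rewrite -comp_lfunNr -comp_lfunDr -lie_ad_br trE.
Qed.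

End Nondegenerate.

(** * Root space decomposition *)

Section RootDecomposition.
Variables (F : closedFieldType) (g : vectType F) (L : lie_algebra g).
Local Notation "[% x , y ]" := (lie_br L x y).

Lemma poly_actXsubC (T : 'End(g)) a v : poly_act T ('X - a%:P) v = T v - a *: v.
Proof. by rewrite -polyCN poly_actD poly_actX poly_actC scaleNr. Qed.

Lemma eigen_gen_eigen (T : 'End(g)) a v : T v = a *: v -> gen_eigen T a v.
Proof. by move=> Tv; exists 1%N; rewrite expr1 poly_actXsubC Tv subrr. Qed.

(** As [ad t] is a derivation, [ad t - (a + b)] sends [[x, y]] to
    [[(ad t - a) x, y] + [x, (ad t - b) y]]; induction on the sum of the exponents
    follows. *)
Lemma gen_eigen_br t a b x y :
  gen_eigen (lie_ad L t) a x -> gen_eigen (lie_ad L t) b y ->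
  gen_eigen (lie_ad L t) (a + b) [% x, y].
Proof.
move=> [m xm] [n yn]; exists (m + n)%N.
have [k mn] : exists k, (m + n)%N = k by exists (m + n)%N.
rewrite mn; elim: k m n x y mn xm yn => [|k IH] [|m] [|n] x y // mn xm yn.
- by move: xm; rewrite expr0 poly_act1 => ->; rewrite lie_br0l linear0.
- by move: xm; rewrite expr0 poly_act1 => ->; rewrite lie_br0l linear0.
- by move: yn; rewrite expr0 poly_act1 => ->; rewrite lie_br0r linear0.
have br_shift : poly_act (lie_ad L t) ('X - (a + b)%:P) [% x, y] =
    [% poly_act (lie_ad L t) ('X - a%:P) x, y] + [% x, poly_act (lie_ad L t) ('X - b%:P) y].
  rewrite !poly_actXsubC -[lie_ad L t x]/[% t, x] -[lie_ad L t y]/[% t, y].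
  rewrite -[lie_ad L t _]/[% t, _] lie_br_derivation lie_brBl lie_brBr.
  rewrite lie_brZl lie_brZr.
  by rewrite scalerDl opprD addrACA.
have [mnk nmk] : (m + n.+1 = k)%N /\ (m.+1 + n = k)%N by lia.
rewrite exprSr poly_actM br_shift linearD /=.
rewrite (IH m n.+1) // -?poly_actM -?exprSr //.
by rewrite (IH m.+1 n) ?addr0 // -poly_actM -exprSr.
Qed.

Variable H : {vspace g}.
Hypotheses (ndeg : killing_nondegenerate L) (cartan_H : is_cartan L H).
Variables (r : nat) (Gamma : r.-tuple (dual_space H)).
Hypothesis simple_Gamma : is_simple_system L Gamma.

Lemma root_space_br (b : dual_space H) t x :
  root_space L b x -> t \in H -> [% t, x] = b (vsproj H t) *: x.
Proof. by move=> bx tH; rewrite -(bx (vsproj H t)) vsprojK. Qed.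

Lemma Gamma_separates t :
  t \in H -> (forall i, tnth Gamma i (vsproj H t) = 0) -> t = 0.
Proof.
move=> tH Gt; have [Gbasis _ _] := simple_Gamma.
have dual0 (b : dual_space H) : b (vsproj H t) = 0.
  rewrite (coord_basis Gbasis (memvf b)) sum_lfunE big1 // => i _.
  by rewrite scale_lfunE -tnth_nth Gt scaler0.
rewrite (coord_vbasis tH) big1 // => i _.
have := dual0 (linfun (coord (vbasis H) i \o vsval : subvs_of H -> F^o)).
by rewrite lfunE /= vsprojK // => ->; rewrite scale0r.
Qed.

(** The bracket of two elements of [H] acts by zero on each simple root vector. *)
Lemma cartan_abelian x y : x \in H -> y \in H -> [% x, y] = 0.
Proof.
move=> xH yH; have [subH _ _] := cartan_H; have [_ Groot _] := simple_Gamma.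
apply: Gamma_separates => [|i]; first exact: subH.
have [_ [v Gv v0]] := Groot i; apply/eqP.
have := lie_br_derivation L x y v; rewrite !(root_space_br Gv) ?subH //.
rewrite !lie_brZr !(root_space_br Gv) //.
rewrite !scalerA [X in X *: v]mulrC -[LHS]add0r => /addIr/esym/eqP.
by rewrite scaler_eq0 (negPf v0) orbF.
Qed.

(** The semisimple part [S] of [ad t] is a derivation, hence [S = ad d]. The
    difference [t - d] commutes with [H], so it lies in [H]; the simple roots
    vanish on it, because [S] and [ad t] agree on eigenvectors of [ad t]. Hence
    [t = d] and [ad t = S]. *)
Lemma cartan_semisimple t : t \in H ->
  exists (s : seq F) (E : F -> {poly F}),
    (forall v, v = \sum_(a <- s) poly_act (lie_ad L t) (E a) v) /\
    (forall a v, a \in s ->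
      [% t, poly_act (lie_ad L t) (E a) v] = a *: poly_act (lie_ad L t) (E a) v).
Proof.
move=> tH; have [s [E [us sumE eigE]]] := primary_decomposition (lie_ad L t).
set T := lie_ad L t in sumE eigE *; exists s, E; split=> //.
pose S := linfun (poly_act T (\sum_(a <- s) a *: E a)).
have SE v : S v = \sum_(a <- s) a *: poly_act T (E a) v.
  by rewrite lfunE /= poly_act_sum; apply: eq_bigr => a _; rewrite poly_actZ.
have S_eigen a v : gen_eigen T a v -> S v = a *: v.
  move=> av; rewrite SE [v in RHS]sumE scaler_sumr.
  apply: eq_big_seq => b bs; have [-> //|ab] := eqVneq a b.
  suff -> : poly_act T (E b) v = 0 by rewrite !scaler0.
  apply: gen_eigen_disjoint ab _ (eigE b v bs).
  by case: av => n nv; exists n; rewrite -poly_actM mulrC poly_actM nv linear0.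
pose is_der x y := S [% x, y] = [% S x, y] + [% x, S y].
have der_subspacel y : is_subspace [set x | is_der x y].
  rewrite /is_der; split=> [|a u v] /=.
    by rewrite linear0 !lie_br0l linear0 addr0.
  rewrite linearP !(lie_br_linearl _ _ a) /= linearP /= => -> ->.
  by rewrite scalerDr addrACA.
have der_subspacer x : is_subspace [set y | is_der x y].
  rewrite /is_der; split=> [|a u v] /=.
    by rewrite linear0 !lie_br0r linear0 addr0.
  rewrite linearP !(lie_br_linearr _ _ a) /= linearP /= => -> ->.
  by rewrite scalerDr addrACA.
have S_der x y : is_der x y.
  rewrite [x]sumE; apply: (subspace_sum (der_subspacel y)) => a a_s /=.
  rewrite [y]sumE; apply: (subspace_sum (der_subspacer _)) => b b_s /=.
  have xa := eigE a x a_s; have yb := eigE b y b_s; rewrite /is_der.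
  rewrite (S_eigen _ _ (gen_eigen_br xa yb)) (S_eigen _ _ xa) (S_eigen _ _ yb).
  rewrite lie_brZl lie_brZr.
  by rewrite scalerDl.
have [d dP] := derivation_inner ndeg S_der.
have S_eigen1 a v : [% t, v] = a *: v -> [% t - d, v] = 0.
  move=> tv; rewrite lie_brBl -dP tv (S_eigen a) ?subrr //.
  exact: eigen_gen_eigen.
have ndH : t - d \in H.
  have [_ _] := cartan_H; apply => y yH.
  by rewrite (S_eigen1 0) ?mem0v // scale0r cartan_abelian.
have /eqP : t - d = 0.
  apply: Gamma_separates => // i; have [_ Groot _] := simple_Gamma.
  have [_ [v Gv v0]] := Groot i; apply/eqP.
  have := root_space_br Gv ndH; rewrite (S_eigen1 _ _ (root_space_br Gv tH)).
  by move/eqP; rewrite eq_sym scaler_eq0 (negPf v0) orbF.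
rewrite subr_eq0 => /eqP td a v a_s.
by rewrite {1}td -dP (S_eigen a) //; apply: eigE.
Qed.

(** The projections on the eigenspaces of [ad t] commute with [ad u] for [u] in
    [H], so they turn eigenvectors of [ad u] into eigenvectors of [ad u]. *)
Lemma joint_eigenvectors (ts : seq g) : {subset ts <= H} ->
  forall v, lspan [set w | forall t, t \in ts -> exists a, [% t, w] = a *: w] v.
Proof.
elim: ts => [|t ts IH] tsH v; first by apply: sub_lspan.
have tH : t \in H by apply: tsH; rewrite mem_head.
have [s [E [sumE eigE]]] := cartan_semisimple tH.
have {}/IH IH : {subset ts <= H} by move=> u uts; apply: tsH; rewrite inE uts orbT.
apply: lspan_mono (IH v) => w wP.
rewrite [w]sumE; apply: subspace_sum => [|a a_s]; first exact: lspan_is_subspace.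
apply: sub_lspan => u; rewrite inE => /predU1P[->|uts]; first by exists a; apply: eigE.
have [b ub] := wP u uts; exists b.
rewrite -[LHS]/(lie_ad L u _) poly_act_comm => [|z].
  by rewrite /= (ub : lie_ad L u w = _) linearZ.
have uH : u \in H by apply: tsH; rewrite inE uts orbT.
change ([% u, [% t, z]] = [% t, [% u, z]]).
rewrite lie_br_derivation (cartan_abelian uH tH).
by rewrite lie_br0l add0r.
Qed.

(** The eigenvalues of a joint eigenvector of a basis of [H] define a linear form on
    [H]. If this form is zero, then the vector commutes with [H], so it lies in
    [H]. *)
Lemma root_decomposition v :
  lspan ([set` H] `|` \bigcup_(b in is_root L (H := H)) root_space L b) v.
Proof.
set A := _ `|` _.
have vbH : {subset vbasis H <= H} by move=> t; apply: vbasis_mem.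
apply: lspan_mono (joint_eigenvectors vbH v) => w wP.
have [-> | w0] := eqVneq w 0; first by case: (lspan_is_subspace A).
have wi (i : 'I_(\dim H)) : exists a, [% (vbasis H)`_i, w] = a *: w.
  by apply: wP; rewrite mem_nth // size_tuple.
have [a aP] := choice wi.
have [|b bE] := @linear_lfun F (subvs_of H) F^o
    (fun t => \sum_i coord (vbasis H) i (vsval t) * a i).
  move=> c t u; rewrite scaler_sumr -big_split; apply: eq_bigr => i _.
  by rewrite /= !linearP /= mulrDl -mulrA.
have bw : root_space L b w.
  move=> t; rewrite bE {1}(coord_vbasis (subvsP t)) scaler_suml.
  rewrite (bilinear_suml (@lie_br_linearl _ _ L)); apply: eq_bigr => i _.
  by rewrite lie_brZl aP scalerA.
apply: sub_lspan; have [b0|b0] := eqVneq b 0; last first.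
  by right; exists b => //; split=> //; exists w.
left; have [_ _] := cartan_H; apply => t tH.
by rewrite lie_brC (root_space_br bw tH) b0 zero_lfunE scale0r oppr0 mem0v.
Qed.

Lemma killing_root_orthogonal (b c : dual_space H) x y :
  root_space L b x -> root_space L c y -> b + c != 0 -> killing L x y = 0.
Proof.
move=> bx cy /lfunPn[t]; rewrite add_lfunE zero_lfunE => bct; apply/eqP.
have := killing_skew L (vsval t) x y; rewrite bx cy.
rewrite killingZl killingZr.
move/eqP; rewrite -addr_eq0 -mulrDl mulf_eq0.
by rewrite (negPf bct).
Qed.

Lemma cartan_root_space0 x : x \in H -> root_space L (0 : dual_space H) x.
Proof. by move=> xH t; rewrite zero_lfunE scale0r cartan_abelian ?subvsP. Qed.

(** The only summand of the root decomposition that is not orthogonal to [g_b] is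
    [g_-b], and the Killing form is nondegenerate. *)
Lemma root_opp (b : dual_space H) x : is_root L b -> root_space L b x -> x != 0 ->
  is_root L (- b) /\ exists2 y, root_space L (- b) y & killing L x y != 0.
Proof.
move=> [b0 _] bx x0.
suff [y by_ kxy] : exists2 y, root_space L (- b) y & killing L x y != 0.
  split; last by exists y.
  split; first by rewrite oppr_eq0.
  by exists y => //; apply: contraNneq kxy => ->; rewrite killing0r.
apply: contrapT => no_y; move/eqP: x0; apply; apply: ndeg => z.
apply: (lspan_ind (W := [set y | killing L x y = 0])) (root_decomposition z).
  split=> [|a u v] /=; first by rewrite killing0r.
  by move=> ku kv; rewrite (@killing_linearr _ _ L) ku kv scaler0 addr0.
move=> y [yH | [c croot cy]] /=.
  by apply: killing_root_orthogonal bx (cartan_root_space0 yH) _; rewrite addr0.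
have [cb|] := eqVneq (b + c) 0; last exact: killing_root_orthogonal bx cy.
apply: contrapT => /eqP kxy; apply: no_y; exists y => //.
by rewrite (addr0_eq cb).
Qed.

End RootDecomposition.

(** * The form on the loop algebra *)

Section Form.
Variables (F : fieldType) (g : vectType F) (L : lie_algebra g) (c1 c2 : F).
Implicit Types (f d : int -> g).
Local Notation Q := (Qform L (a_series c1 c2)).

Lemma QformC f d : Q f d = Q d f.
Proof.
have killing_flip : (fun y x => killing L x y) = killing L.
  by apply/funext => x; apply/funext => y; apply: killingC.
by rewrite /Qform [conv (killing L) f d]conv_flip killing_flip.
Qed.

Lemma Qform_ev f d : c1 != 0 -> c2 != 0 ->
  @laurent_poly g f -> @laurent_poly g d ->
  (forall i l : int, 0 < i + l -> killing L (f i) (d l) = 0) ->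
  (c1 - c2) * Q f d = Qbar L (ev c1 f, ev c2 f) (ev c1 d, ev c2 d).
Proof.
move=> c10 c20 fP dP fd0.
have lin1 := @killing_linearl _ _ L; have lin2 := @killing_linearr _ _ L.
rewrite /Qform residue_nonpositive.
- by rewrite !(ev_conv lin1 lin2).
- by case: (conv_laurent_poly lin1 lin2 fP dP).
- move=> n n0; apply: fsbig1 => i _.
  by apply: fd0; rewrite addrC subrK.
Qed.

Lemma Qform_two_zeros f s y : c1 != c2 -> @laurent g f ->
  Q f (two_zeros c1 c2 s y) = killing L (f (1 - s)) y.
Proof.
move=> c12 [N fN]; pose phi n := killing L (f (n - (s - 2))) y.
rewrite /Qform (@residue_two_factors _ _ _ c12 _ phi).
- by congr (killing L (f _) y); lia.
- exists (N + (s - 2)) => n nN.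
  by rewrite /phi fN ?killing0l //; lia.
move=> n; rewrite (conv_two_zeros _ _ _ _ _ _ (@killing_linearr _ _ L)) /phi.
have -> : n - 1 - (s - 2) = n - (s - 1) by lia.
have -> : n - 2 - (s - 2) = n - s by lia.
rewrite -[X in X - _ + _]/(c1 * c2 * _) -[X in _ - X + _]/((c1 + c2) * _); ring.
Qed.

End Form.

(** * Coordinates of roots *)

Section Coordinates.
Variables (F : numClosedFieldType) (g : vectType F) (L : lie_algebra g).
Variables (H : {vspace g}) (r : nat) (Gamma : r.-tuple (dual_space H)).
Hypothesis simple_Gamma : is_simple_system L Gamma.
Variable j : 'I_r.

Lemma coord_nonneg_comb b : nonneg_comb Gamma b -> exists n, coord Gamma j b = n%:R.
Proof.
move=> [n ->]; exists (n j); have [/basis_free Gfree _ _] := simple_Gamma.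
rewrite -[RHS](coord_sum_free (fun i => (n i)%:R) j Gfree); congr (coord _ _ _).
by apply: eq_bigr => i _; rewrite (tnth_nth 0).
Qed.

Lemma root_coord (b : dual_space H) : is_root L b ->
  exists2 m : int, coord Gamma j b = m%:~R &
    (0 <= m /\ nonneg_comb Gamma b) \/ (m <= 0 /\ nonneg_comb Gamma (- b)).
Proof.
have [_ _ /[apply]] := simple_Gamma; case=> nb; have [n bn] := coord_nonneg_comb nb.
  by exists n%:Z => //; left.
exists (- n%:Z); last by right; split=> //; lia.
by move: bn; rewrite linearN => /eqP; rewrite eqr_oppLR rmorphN => /eqP.
Qed.

Lemma value_at_order_point k h (b : dual_space H) :
  is_order_point L Gamma j k h -> b h = coord Gamma j b / k%:R.
Proof.
move=> [_ hE]; have [Gbasis _ _] := simple_Gamma.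
rewrite [in LHS](coord_basis Gbasis (memvf b)) sum_lfunE (bigD1 j) //= big1 => [|i ij].
  by rewrite scale_lfunE -tnth_nth hE eqxx addr0 mul1r.
by rewrite scale_lfunE -tnth_nth hE (negPf ij) mul0r scaler0.
Qed.

Lemma coord_Gamma : coord Gamma j (tnth Gamma j) = 1.
Proof.
have [/basis_free Gfree _ _] := simple_Gamma.
by rewrite (tnth_nth 0) coord_free ?eqxx.
Qed.

End Coordinates.

(** * Orders *)

(** A condition on coefficients that is linear holds on all of [O_h] once it
    holds for the monomials [x u^n] of [O_h] with [x] in [H] or in a root space. *)
Lemma O_coefficients (F : numFieldType) (g : vectType F) (L : lie_algebra g)
    (H : {vspace g}) (h : subvs_of H) (P : int -> set g) :
  (forall n, is_subspace (P n)) ->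
  (forall n x, n <= 0 -> x \in H -> P n x) ->
  (forall (b : dual_space H) x n, is_root L b -> root_space L b x ->
     b h <= (- n)%:~R -> P n x) ->
  forall f, O_ L h f -> forall n, P n (f n).
Proof.
move=> PS PH Pb f Of.
pose W := [set f : int -> g | forall n, P n (f n)].
have WS : is_subspace W.
  split=> [n|a x y Wx Wy n]; first by case: (PS n).
  by rewrite !fctE; have [_] := PS n; apply.
apply: (lspan_ind WS _ Of) => {f Of} f [[fH f0] n | [b broot]].
  have [n0|/f0 ->] := leP n 0; first by apply: PH.
  by case: (PS n).
apply: (lspan_ind WS) => {}f [m [x [[_ mb] bx ->]]] n /=.
have [->|mn] := eqVneq (m n) 0; first by rewrite scale0r; case: (PS n).
apply: subspaceZ => //; case: mb => [m0|[v [_ mv] bv]].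
  by rewrite m0 eqxx in mn.
apply: Pb broot bx _; apply: le_trans bv _; rewrite ler_int.
by rewrite leNgt; apply: contra mn => /mv; rewrite opprK => ->.
Qed.

Lemma killing_kernel_subspace (F : fieldType) (g : vectType F) (L : lie_algebra g) x :
  is_subspace [set z | killing L z x = 0].
Proof.
split=> [|a u v] /=; first by rewrite killing0l.
by move=> ku kv; rewrite (@killing_linearl _ _ L) ku kv scaler0 addr0.
Qed.

Lemma subspace_if (F : fieldType) (U : lmodType F) (C : Prop) (W : set U) :
  is_subspace W -> is_subspace [set z | C -> W z].
Proof.
move=> [W0 WS]; split=> // a x y Wx Wy c.
by apply: WS; [apply: Wx | apply: Wy].
Qed.

(** * Coefficient greater than one *)

Section NoLagrangian.
Variables (F : numClosedFieldType) (g : vectType F) (L : lie_algebra g).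
Variables (H : {vspace g}) (r : nat) (Gamma : r.-tuple (dual_space H)).
Hypotheses (ndeg : killing_nondegenerate L) (cartan_H : is_cartan L H).
Hypothesis simple_Gamma : is_simple_system L Gamma.
Variables (j : 'I_r) (k : nat) (h : subvs_of H).
Hypothesis def_h : is_order_point L Gamma j k h.

(** For [x] in [g_-a], with [a] the given simple root, [f = x u (u^-1 - c1) (u^-1 - c2)]
    is orthogonal to [O_h], since [a h > 0] excludes [u^n] with [n >= 0] from the
    component of [O_h] along [g_a]. So [f] lies in [W], although it has a term in [u],
    which [- a h > -1] excludes from the component along [g_-a]. *)
Lemma no_lagrangian_in_order (c1 c2 : F) (W : set (int -> g)) :
  c1 != 0 -> c2 != 0 -> c1 != c2 -> (1 < k)%N ->
  lagrangian_subalgebra (@laurent g) (conv (lie_br L)) (Qform L (a_series c1 c2)) W ->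
  ~ W `<=` O_ L h `&` @laurent_poly g.
Proof.
move=> c10 c20 c12 k1 [WV _ _ WE] WO.
have [_ Groot _] := simple_Gamma; set a := tnth Gamma j.
have [_ [y ya y0]] := Groot j.
have [_ [x xa kyx]] := root_opp ndeg cartan_H simple_Gamma (Groot j) ya y0.
have ah : a h = k%:R^-1 :> F.
  by rewrite (value_at_order_point simple_Gamma _ def_h) (coord_Gamma simple_Gamma) mul1r.
have kgt0 : 0 < k%:R :> F by rewrite ltr0n; apply: ltn_trans k1.
have Ox d : O_ L h d -> forall n, 0 <= n -> killing L (d n) x = 0.
  move=> Od n; pose P (n : int) := [set z | 0 <= n -> killing L z x = 0].
  suff : P n (d n) by [].
  apply: O_coefficients Od n => [n|n z n0 zH|b z n broot bz bn] /=.
  - by apply: subspace_if; apply: killing_kernel_subspace.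
  - move=> _.
    apply: killing_root_orthogonal (cartan_root_space0 cartan_H simple_Gamma zH) xa _.
    by rewrite add0r oppr_eq0; case: (Groot j).
  move=> n0; have [ba|] := eqVneq (b - a) 0; last exact: killing_root_orthogonal bz xa.
  move: bn; rewrite (subr0_eq ba) ah => bn.
  have : 0 < (- n)%:~R :> F by apply: lt_le_trans bn; rewrite invr_gt0.
  by rewrite ltr0z oppr_gt0 ltNge n0.
have Oy d : O_ L h d -> killing L (d 1) y = 0.
  move=> Od; pose P (n : int) := [set z | n = 1 -> killing L z y = 0].
  suff : P 1 (d 1) by apply.
  apply: O_coefficients Od 1 => [n|n z n0 zH|b z n broot bz bn] /=.
  - by apply: subspace_if; apply: killing_kernel_subspace.
  - by move=> n1; move: n0; rewrite n1.
  move=> n1; have [ba|] := eqVneq (b + a) 0; last exact: killing_root_orthogonal bz ya.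
  move: bn; rewrite n1 (canRL (addrK a) ba) add0r opp_lfunE ah mulrN1z lerN2 => k_inv.
  have : k%:R <= 1 :> F by rewrite -[k%:R]invrK invf_le1 ?invr_gt0.
  by rewrite (ler_nat _ k 1) leqNgt k1.
have Wf : W (two_zeros c1 c2 1 x).
  rewrite WE; split; first by case: (two_zeros_laurent_poly c1 c2 1 x).
  move=> d Wd; have [Od _] := WO d Wd.
  by rewrite QformC (Qform_two_zeros _ _ _ c12 (WV d Wd)) subrr Ox.
have [/Oy] := WO _ Wf; rewrite /two_zeros eqxx.
rewrite killingZl killingC => /eqP.
by rewrite !mulf_eq0 (negPf c10) (negPf c20) (negPf kyx).
Qed.

End NoLagrangian.

(** * The grading *)

Section Grading.
Variables (F : numFieldType) (g : vectType F) (L : lie_algebra g) (t : g).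
Local Notation "[% x , y ]" := (lie_br L x y).

Definition weight_space (m : int) : set g := [set x | [% t, x] = m%:~R *: x].

Lemma weight_space_subspace m : is_subspace (weight_space m).
Proof.
split=> [|a x y]; rewrite /weight_space /= ?lie_br0r ?scaler0 //.
move=> xm ym; rewrite (lie_br_linearr _ _ a) /= xm ym scalerDr !scalerA.
by rewrite [a * _]mulrC.
Qed.

Lemma weight_space_br m n x y :
  weight_space m x -> weight_space n y -> weight_space (m + n) [% x, y].
Proof.
move=> xm yn; rewrite /weight_space /= lie_br_derivation xm yn.
rewrite lie_brZl lie_brZr.
by rewrite rmorphD scalerDl.
Qed.

Lemma killing_weight_space m n x y :
  weight_space m x -> weight_space n y -> m + n != 0 -> killing L x y = 0.
Proof.
move=> xm yn mn0; have := killing_skew L t x y; rewrite xm yn.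
rewrite killingZl killingZr.
move/eqP; rewrite -addr_eq0 -mulrDl mulf_eq0.
by rewrite -rmorphD /= intr_eq0 (negPf mn0) => /eqP.
Qed.

Lemma weight_space_independent (s : seq int) (y : int -> g) :
  uniq s -> (forall m, weight_space m (y m)) -> \sum_(m <- s) y m = 0 ->
  forall m, m \in s -> y m = 0.
Proof.
elim: s y => [|n s IH] y //= /andP[n_s us] yP ysum m.
have ys m' : m' \in s -> y m' = 0.
  move=> m's; apply/eqP.
  have : (m' - n)%:~R *: y m' = 0.
    apply: (IH (fun i => (i - n)%:~R *: y i)) => // [i|].
      exact: (subspaceZ _ (weight_space_subspace i) (yP i)).
    have := congr1 (lie_br L t) ysum.
    rewrite (bilinear_sumr (@lie_br_linearr _ _ L)) lie_br0r.
    rewrite (eq_bigr (fun i => i%:~R *: y i)) => [tsum|i _]; last exact: yP.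
    have nsum : \sum_(i <- n :: s) n%:~R *: y i = 0 by rewrite -scaler_sumr ysum scaler0.
    transitivity (\sum_(i <- n :: s) i%:~R *: y i - \sum_(i <- n :: s) n%:~R *: y i).
      rewrite -sumrB big_cons subrr add0r.
      by apply: eq_bigr => i _; rewrite rmorphB scalerBl.
    by rewrite tsum nsum subrr.
  move/eqP; rewrite scaler_eq0 intr_eq0 subr_eq0 => /predU1P[m'n|//].
  by rewrite -m'n m's in n_s.
rewrite inE => /predU1P[->|]; last exact: ys.
by rewrite -ysum big_cons big_seq big1 ?addr0.
Qed.

(** The coefficients of [u^n] in the sum over [m] of the spaces [u^-m g_m[u^-1]], where
    [g_m] is the space of weight [m]. *)
Definition filtration (n : int) : set g :=
  lspan (\bigcup_(m in [set m | m <= - n]) weight_space m).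

Lemma filtration_subspace n : is_subspace (filtration n).
Proof. exact: lspan_is_subspace. Qed.

Lemma weight_space_filtration m n x : m <= - n -> weight_space m x -> filtration n x.
Proof. by move=> mn xm; apply: sub_lspan; exists m. Qed.

Lemma filtration_mono m n : m <= n -> filtration n `<=` filtration m.
Proof.
move=> mn; apply: lspan_mono => x [p /= pn xp].
by apply: weight_space_filtration xp; lia.
Qed.

Lemma filtration_br m n x y :
  filtration m x -> filtration n y -> filtration (m + n) [% x, y].
Proof.
move=> xm yn; have FS := filtration_subspace (m + n); have [F0 FD] := FS.
apply: (lspan_ind (W := [set x | filtration (m + n) [% x, y]])) xm.
  split=> [|a u v] /=; first by rewrite lie_br0l.
  by move=> um vm; rewrite (lie_br_linearl _ _ a); apply: FD.
move=> {}x [p /= pm xp]; apply: (lspan_ind (W := [set y | filtration (m + n) [% x, y]])) yn.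
  split=> [|a u v] /=; first by rewrite lie_br0r.
  by move=> um vm; rewrite (lie_br_linearr _ _ a); apply: FD.
move=> {}y [q /= qn yq]; apply: weight_space_filtration (weight_space_br xp yq).
by lia.
Qed.

Lemma killing_filtration m n x y :
  filtration m x -> filtration n y -> 0 < m + n -> killing L x y = 0.
Proof.
move=> xm yn mn.
apply: (lspan_ind (killing_kernel_subspace L y) _ xm).
move=> {xm}x [p /= pm xp]; rewrite killingC.
apply: (lspan_ind (killing_kernel_subspace L x) _ yn).
move=> {yn}y [q /= qn yq]; apply: killing_weight_space yq xp _.
by lia.
Qed.

Definition filtered : set (int -> g) :=
  [set f | @laurent g f /\ forall n, filtration n (f n)].

Lemma filtered_subspace : is_subspace filtered.
Proof.
have [l0 lS] := laurent_is_subspace g.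
split=> [|a x y [xl xn] [yl yn]].
  by split=> // n; exact: (subspace0 (filtration_subspace n)).
split=> [|n]; first exact: lS.
by rewrite !fctE; have [_] := filtration_subspace n; apply.
Qed.

Lemma filtered_br f d : filtered f -> filtered d -> filtered (conv (lie_br L) f d).
Proof.
move=> [fl fn] [dl dn]; split.
  exact: (conv_laurent (@lie_br_linearl _ _ L) (@lie_br_linearr _ _ L) fl dl).
move=> n; rewrite /conv; elim/big_ind: _ => [|x y|i _].
- exact: (subspace0 (filtration_subspace n)).
- by move=> xn yn; apply: (subspaceD (filtration_subspace n) xn yn).
by have := filtration_br (fn i) (dn (n - i)); rewrite addrC subrK.
Qed.

Lemma filtered_two_zeros (c1 c2 : F) m s y : s + m <= 0 -> weight_space m y ->
  filtered (two_zeros c1 c2 s y).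
Proof.
move=> sm ym; split=> [|n]; first by case: (two_zeros_laurent_poly c1 c2 s y).
have fS := filtration_subspace n; rewrite /two_zeros.
case: ifP => [/eqP ->|_].
  by apply: (subspaceZ _ (filtration_subspace s)); apply: weight_space_filtration ym; lia.
case: ifP => [/eqP ->|_].
  by apply: (subspaceZ _ (filtration_subspace _)); apply: weight_space_filtration ym; lia.
case: ifP => [/eqP ->|_]; last exact: (subspace0 fS).
by apply: weight_space_filtration ym; lia.
Qed.

Definition short_grading : Prop := forall x, exists y : int -> g,
  (forall m, weight_space m (y m)) /\ x = \sum_(m <- [:: -1; 0; 1]) y m.
Hypothesis t_short : short_grading.

Lemma weight_space_out m x : 1 < `|m| -> weight_space m x -> x = 0.
Proof.
move=> m1 xm; have [y [yP xE]] := t_short x.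
pose z i := if i == m then - x else y i.
have ms : m \notin [:: -1; 0; 1] by rewrite !inE; lia.
have /(_ m) : forall i, i \in m :: [:: -1; 0; 1] -> z i = 0.
  apply: weight_space_independent; first by rewrite cons_uniq ms.
    move=> i; rewrite /z; case: eqP => [->|_]; last exact: yP.
    exact: (subspaceN (weight_space_subspace m) xm).
  have -> : \sum_(i <- m :: [:: -1; 0; 1]) z i = - x + \sum_(i <- [:: -1; 0; 1]) y i.
    rewrite big_cons {1}/z eqxx; congr (_ + _); apply: eq_big_seq => i i_s.
    by rewrite /z ifN //; apply: contraNneq ms => <-.
  by rewrite -xE addNr.
by rewrite mem_head /z eqxx => /(_ isT)/eqP; rewrite oppr_eq0 => /eqP.
Qed.

Lemma filtration_full n x : n < 0 -> filtration n x.
Proof.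
move=> n0; have [y [yP ->]] := t_short x.
apply: subspace_sum (filtration_subspace n) _ => m m_s.
apply: weight_space_filtration (yP m).
by move: m_s; rewrite !inE; lia.
Qed.

Lemma filtration_zero n x : 1 < n -> filtration n x -> x = 0.
Proof.
move=> n1 xn; apply: (lspan_ind (W := [set 0]) _ _ xn) => [|{xn}x [m /= mn xm]].
  by split=> // a u v -> ->; rewrite scaler0 addr0.
by apply: weight_space_out xm; lia.
Qed.

Lemma filtration1 x : filtration 1 x <-> weight_space (-1) x.
Proof.
split=> [xf|]; last by apply: weight_space_filtration.
apply: (lspan_ind (weight_space_subspace (-1)) _ xf) => {xf}x [m /= mn xm].
have [m1|m1] := eqVneq m (-1); first by rewrite -m1.
rewrite (weight_space_out _ xm); last by lia.
exact: (subspace0 (weight_space_subspace _)).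
Qed.

Lemma filtration0 x : filtration 0 x <->
  exists a b, [/\ weight_space 0 a, weight_space (-1) b & x = a + b].
Proof.
split=> [xf|[a [b [a0 b1 ->]]]]; last first.
  apply: subspaceD (filtration_subspace 0) _ _.
    exact: weight_space_filtration a0.
  exact: weight_space_filtration b1.
have [[z0 zS] [o0 oS]] := (weight_space_subspace 0, weight_space_subspace (-1)).
apply: (lspan_ind (W := [set x | exists a b,
  [/\ weight_space 0 a, weight_space (-1) b & x = a + b]]) _ _ xf).
  split=> [|c u v [a [b [a0 b1 ->]]] [a' [b' [a0' b1' ->]]]].
    by exists 0, 0; rewrite addr0.
  exists (c *: a + a'), (c *: b + b'); split; [exact: zS | exact: oS |].
  by rewrite scalerDr addrACA.
move=> {xf}x [m /= m0 xm].
have [mE|mn1] := eqVneq m (-1); first by exists 0, x; rewrite add0r -mE.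
have [mE|mn0] := eqVneq m 0; first by exists x, 0; rewrite addr0 -mE.
by exists 0, 0; rewrite addr0 (weight_space_out _ xm) //; lia.
Qed.

Lemma filtered_laurent_poly f : filtered f -> @laurent_poly g f.
Proof.
by move=> [fl fn]; split=> //; exists 1 => n n1; apply: filtration_zero (fn n).
Qed.

(** The Killing form pairs weight [- m] with weight [m], so orthogonality to all
    weights [m < n] leaves to [x] the weights [<= - n] only. *)
Lemma filtration_orthogonal n x : killing_nondegenerate L ->
  (forall m y, m < n -> weight_space m y -> killing L x y = 0) -> filtration n x.
Proof.
move=> ndeg xP; have [y [yP xE]] := t_short x.
rewrite xE; apply: subspace_sum (filtration_subspace n) _ => m m_s.
have [mn|mn] := leP m (- n); first exact: weight_space_filtration (yP m).
suff -> : y m = 0 by exact: (subspace0 (filtration_subspace n)).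
apply: ndeg => z; have [w [wP ->]] := t_short z.
rewrite (bilinear_sumr (@killing_linearr _ _ L)) big1_seq // => i _.
have [im|im] := eqVneq (m + i) 0; last exact: killing_weight_space (yP m) (wP i) im.
rewrite -[RHS](xP i (w i)) //; last by lia.
rewrite xE (bilinear_suml (@killing_linearl _ _ L)) (bigD1_seq m) //=.
rewrite big1 ?addr0 // => p pm; apply: killing_weight_space (yP p) (wP i) _.
by apply: contra pm => /eqP; lia.
Qed.

End Grading.

(** * The grading of a simple root of coefficient one *)

Section ShortGrading.
Variables (F : numClosedFieldType) (g : vectType F) (L : lie_algebra g).
Variables (H : {vspace g}) (r : nat) (Gamma : r.-tuple (dual_space H)).
Hypotheses (ndeg : killing_nondegenerate L) (cartan_H : is_cartan L H).
Hypothesis simple_Gamma : is_simple_system L Gamma.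
Variables (j : 'I_r) (h : subvs_of H) (theta : dual_space H).
Hypothesis max_theta : is_maximal_root L Gamma theta.
Hypothesis theta_coord : coord Gamma j theta = 1.
Hypothesis def_h : is_order_point L Gamma j 1 h.

Lemma root_coord_le1 (b : dual_space H) (m : int) :
  is_root L b -> coord Gamma j b = m%:~R -> m <= 1.
Proof.
move=> broot bm; have [n] := coord_nonneg_comb simple_Gamma j (max_theta.2 b broot).
rewrite linearB /= theta_coord bm => /eqP; rewrite subr_eq => /eqP nm.
have : (1 : F) = (n%:Z + m)%:~R by rewrite rmorphD.
by move/(@intr_inj F 1) => ?; lia.
Qed.

(** The bound from maximality applies to [- b] as well, which is a root. *)
Lemma root_weight (b : dual_space H) : is_root L b ->
  exists m : int, [/\ coord Gamma j b = m%:~R, - 1 <= m <= 1 &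
    (0 <= m /\ nonneg_comb Gamma b) \/ (m <= 0 /\ nonneg_comb Gamma (- b))].
Proof.
move=> broot; have [m bm mb] := root_coord simple_Gamma j broot.
have [_ [x bx x0]] := broot.
have [Nbroot _] := root_opp ndeg cartan_H simple_Gamma broot bx x0.
exists m; split=> //; rewrite (root_coord_le1 broot bm) andbT.
have := @root_coord_le1 (- b) (- m) Nbroot.
by rewrite linearN /= bm rmorphN => /(_ erefl); lia.
Qed.

Lemma root_value (b : dual_space H) (m : int) : coord Gamma j b = m%:~R -> b h = m%:~R.
Proof. by move=> bm; rewrite (value_at_order_point simple_Gamma b def_h) bm divr1. Qed.

Local Notation t := (vsval h).
Local Notation gr := (weight_space L t).
Local Notation fil := (filtration L t).

Lemma root_weight_space b m x : coord Gamma j b = m%:~R -> root_space L b x -> gr m x.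
Proof. by move=> bm bx; rewrite /weight_space /= bx (root_value bm). Qed.

Lemma cartan_weight0 x : x \in H -> gr 0 x.
Proof.
move=> /(cartan_root_space0 cartan_H simple_Gamma) /root_weight_space; apply.
by rewrite linear0.
Qed.

(** Equal to the space of weight [m], but generated by the vectors that also generate
    the order and the parabolic subalgebra. *)
Definition weight_span (m : int) : set g :=
  lspan ([set x | m = 0 /\ x \in H] `|`
         \bigcup_(b in [set b | is_root L b /\ coord Gamma j b = m%:~R]) root_space L b).

Lemma weight_span_subspace m : is_subspace (weight_span m).
Proof. exact: lspan_is_subspace. Qed.

Lemma weight_span_weight_space m x : weight_span m x -> gr m x.
Proof.
apply: (lspan_ind (weight_space_subspace L t m)) => y [[-> yH]|[b [_ bm] by_]].
  exact: cartan_weight0.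
exact: root_weight_space by_.
Qed.

Lemma weight_decomposition x : exists y : int -> g,
  (forall m, weight_span m (y m)) /\ x = \sum_(m <- [:: -1; 0; 1]) y m.
Proof.
have single m x' : m \in [:: -1; 0; 1] -> weight_span m x' ->
    exists y : int -> g,
    (forall m, weight_span m (y m)) /\ x' = \sum_(m <- [:: -1; 0; 1]) y m.
  move=> ms xm; exists (fun i => if i == m then x' else 0); split=> [i|].
    by case: eqP => [->//|_]; apply: (subspace0 (weight_span_subspace i)).
  rewrite (bigD1_seq m) //= eqxx big1 ?addr0 // => i /negPf ->//.
apply: (lspan_ind (W := [set x | exists y : int -> g,
  (forall m, weight_span m (y m)) /\ x = \sum_(m <- [:: -1; 0; 1]) y m])) 
  (root_decomposition ndeg cartan_H simple_Gamma x).
  split=> [|a u v [y [yP ->]] [z [zP ->]]].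
    exists (fun=> 0); split=> [m|]; last by rewrite big1.
    exact: (subspace0 (weight_span_subspace m)).
  exists (fun m => a *: y m + z m); split=> [m|].
    by have [_] := weight_span_subspace m; apply.
  by rewrite scaler_sumr -big_split.
move=> {}x [xH|[b broot bx]].
  by apply: (single 0) => //; apply: sub_lspan; left.
have [m [bm m1 _]] := root_weight broot; apply: (single m).
  by rewrite !inE; lia.
by apply: sub_lspan; right; exists b.
Qed.

Lemma order_point_short : short_grading L t.
Proof.
move=> x; have [y [yP xE]] := weight_decomposition x.
by exists y; split=> // m; apply: weight_span_weight_space.
Qed.

Lemma weight_space_weight_span m x : gr m x -> weight_span m x.
Proof.
move=> xm; have [ms|ms] := boolP (m \in [:: -1; 0; 1]); last first.
  rewrite (weight_space_out order_point_short _ xm).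
    exact: (subspace0 (weight_span_subspace m)).
  by move: ms; rewrite !inE; lia.
have [y [yP xE]] := weight_decomposition x.
pose z i := if i == m then y m - x else y i.
suff /eqP : z m = 0 by rewrite /z eqxx subr_eq0 => /eqP <-.
apply: (@weight_space_independent _ _ L t [:: -1; 0; 1] z _ _ _ m ms) => // [i|].
  rewrite /z; case: eqP => [->|_]; last exact: weight_span_weight_space.
  exact: (subspaceB (weight_space_subspace L t m) (weight_span_weight_space (yP m)) xm).
rewrite (bigD1_seq m) //= {1}/z eqxx addrAC.
rewrite (eq_bigr y) => [|i /negPf im]; last by rewrite /z im.
by rewrite -bigD1_seq //= -xE subrr.
Qed.

(** * The order of a coefficient-one root *)

Lemma monomial_order_subspace n : is_subspace [set x | O_ L h (monomial n x)].
Proof.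
have [O0 OS] := lspan_is_subspace
  (h_taylor_inv H `|` \bigcup_(b in @is_root F g L H) M_tensor L b h).
split=> [|a u v un vn] /=.
  rewrite (_ : monomial n 0 = 0) //.
  by apply/funext => i; rewrite /monomial; case: ifP.
rewrite (_ : monomial n _ = a *: monomial n u + monomial n v); first exact: OS.
apply/funext => i; rewrite !fctE /monomial; case: ifP => // _.
by rewrite scaler0 addr0.
Qed.

Lemma monomial_order n x : fil n x -> O_ L h (monomial n x).
Proof.
apply: (lspan_ind (monomial_order_subspace n)) => {}x [m /= mn /weight_space_weight_span].
apply: (lspan_ind (monomial_order_subspace n)) => y.
move=> [[m0 yH]|[b [broot bm] by_]]; apply: sub_lspan.
  left; split=> i; rewrite /monomial; first by case: ifP => // _; apply: mem0v.
  by case: eqP => // -> n0; lia.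
right; exists b => //; apply: sub_lspan.
exists (fun i => (i == n)%:R), y; split=> //; last first.
  by apply/funext => i; rewrite /monomial; case: eqP; rewrite ?scale1r ?scale0r.
split; first by exists n => i ni; case: eqP => // iE; move: ni; rewrite iE ltxx.
right; exists (- n).
  split; first by rewrite opprK eqxx oner_eq0.
  by move=> i ni; case: eqP => // iE; lia.
by rewrite (root_value bm) ler_int.
Qed.

(** A root of weight [m] takes the integral value [m] at [h], so the valuation
    condition along its root space says that [u^n] occurs for [n <= - m] only. *)
Lemma order_filtered : O_ L h `&` @laurent_poly g = filtered L t.
Proof.
apply/seteqP; split=> f.
  move=> [Of [fl _]]; split=> // ; move: f Of {fl}; apply: O_coefficients.
  - exact: filtration_subspace.
  - by move=> n x n0 xH; apply: weight_space_filtration (cartan_weight0 xH); lia.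
  - move=> b x n broot bx bn; have [m [bm _ _]] := root_weight broot.
    apply: weight_space_filtration (root_weight_space bm bx).
    by move: bn; rewrite (root_value bm) ler_int.
move=> fF; have fP := filtered_laurent_poly order_point_short fF.
split=> //; have [s us fs] := laurent_poly_support fP.
have OS := lspan_is_subspace
  (h_taylor_inv H `|` \bigcup_(b in @is_root F g L H) M_tensor L b h).
have -> : f = \sum_(n <- s) monomial n (f n).
  apply/funext => i; rewrite fct_sumE; have [i_s|i_s] := boolP (i \in s).
    rewrite (bigD1_seq i) //= {1}/monomial eqxx big1 ?addr0 // => n.
    by rewrite eq_sym /monomial => /negPf ->.
  rewrite (fs i i_s) big_seq big1 // => n ns; rewrite /monomial ifN //.
  by apply: contraNneq i_s => ->.
apply: (subspace_sum OS) => n _; have [_ /(_ n) fn] := fF.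
exact: monomial_order.
Qed.

(** * The parabolic subalgebra *)

Lemma parabolic_filtration x : parabolic L Gamma j x <-> fil 0 x.
Proof.
split; last first.
  apply: lspan_mono => y [m /= m0 /weight_space_weight_span].
  apply: lspan_mono => {}y [[_ yH]|[b [broot bm] by_]]; apply: sub_lspan; first by left.
  right; exists b => //; have [p [bp _ pn]] := root_weight broot.
  case: pn => [[p0 bn]|[_ bn]]; last by left.
  right; split=> //; rewrite /contains bp.
  have /(@intr_inj F) pm : p%:~R = m%:~R :> F by rewrite -bp -bm.
  by rewrite (_ : p = 0) ?eqxx //; lia.
apply: (lspan_ind (filtration_subspace L t 0)) => y [yH|[b bP by_]].
  by apply: weight_space_filtration (cartan_weight0 yH).
have [broot bm] : is_root L b /\ exists2 m : int, coord Gamma j b = m%:~R & m <= 0.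
  case: bP => [[broot bn]|[[broot bn] /negP bj]]; split=> //; last first.
    by exists 0 => //; apply/eqP; rewrite -[_ == _]negbK.
  have [n bE] := coord_nonneg_comb simple_Gamma j bn.
  exists (- n%:Z); last by lia.
  by rewrite rmorphN /= -pmulrn -bE linearN /= opprK.
have [m bE m0] := bm; apply: weight_space_filtration (root_weight_space bE by_).
by rewrite oppr0.
Qed.

Lemma reductive_part_weight0 x : reductive_part L Gamma j x <-> gr 0 x.
Proof.
split; last first.
  move=> /weight_space_weight_span; apply: lspan_mono => y [[_ yH]|[b [broot b0] by_]];
    apply: sub_lspan; first by left.
  by right; exists b => //; split=> //; rewrite /contains b0 eqxx.
apply: (lspan_ind (weight_space_subspace L t 0)) => y [yH|[b [broot /negP bj] by_]].
  exact: cartan_weight0.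
by apply: root_weight_space by_; apply/eqP; rewrite -[_ == _]negbK.
Qed.

Lemma nilradical_weight x : parabolic_nilradical L Gamma j x <-> gr (-1) x.
Proof.
split; last first.
  move=> /weight_space_weight_span; apply: lspan_mono => y [[//]|[b [broot bm] by_]].
  apply: sub_lspan; exists b => //; have [p [bp _ pn]] := root_weight broot.
  have /(@intr_inj F) pm : p%:~R = (-1)%:~R :> F by rewrite -bp -bm.
  split; last by rewrite /contains bm mulrN1z oppr_eq0 oner_eq0.
  by split=> //; case: pn => [[p0 _]|[_ //]]; move: p0; rewrite pm.
apply: (lspan_ind (weight_space_subspace L t (-1))) => y [b [[broot bn] bj] by_].
have [m [bm m1 _]] := root_weight broot; apply: root_weight_space by_; rewrite bm.
have [n bE] := coord_nonneg_comb simple_Gamma j bn.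
move: bE; rewrite linearN /= bm -rmorphN => /(@intr_inj F _ n%:Z) mn.
have m0 : m != 0 by apply: contraNneq bj => m0; rewrite bm m0.
by congr (_%:~R); lia.
Qed.

(** Elements of weights [0] and [-1] have the same reductive part exactly when their
    difference has weight [-1]. *)
Lemma DeltaE p : Delta L Gamma j p <->
  [/\ fil 0 p.1, fil 0 p.2 & gr (-1) (p.1 - p.2)].
Proof.
have gS := weight_space_subspace L t (-1); split.
  move=> [/parabolic_filtration p1 /parabolic_filtration p2].
  move=> [l [_ /nilradical_weight n1] [_ /nilradical_weight n2]].
  split=> //; rewrite (_ : p.1 - p.2 = (p.1 - l) - (p.2 - l)).
    exact: (subspaceB gS n1 n2).
  by rewrite opprB addrA subrK.
move=> [p1 p2 p12]; split; [exact/parabolic_filtration | exact/parabolic_filtration |].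
have [l [n [l0 n1 pE]]] := (filtration0 order_point_short p.1).1 p1.
exists l; split; first exact/reductive_part_weight0.
- by apply/nilradical_weight; rewrite pE addrC addKr.
- exact/reductive_part_weight0.
apply/nilradical_weight; rewrite (_ : p.2 - l = n - (p.1 - p.2)).
  exact: (subspaceB gS n1 p12).
by rewrite pE opprB addrCA opprD [n + _]addrCA subrr addr0.
Qed.

End ShortGrading.

Section Correspondence.
Variables (F : numFieldType) (g : vectType F) (L : lie_algebra g) (t : g).
Hypotheses (ndeg : killing_nondegenerate L) (t_short : short_grading L t).
Variables (c1 c2 : F).
Hypotheses (c1_neq0 : c1 != 0) (c2_neq0 : c2 != 0) (c1_neq_c2 : c1 != c2).
Local Notation Q := (Qform L (a_series c1 c2)).
Local Notation D := (filtered L t).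
Implicit Types (f d : int -> g) (p q : g * g) (W : set (int -> g)) (X : set (g * g)).

Definition ev2 f : g * g := (ev c1 f, ev c2 f).

Let DS : is_subspace D := filtered_subspace L t.
Let DP f : D f -> @laurent_poly g f := @filtered_laurent_poly F g L t t_short f.

Lemma ev2_linear a f d : D f -> D d -> ev2 (a *: f + d) = a *: ev2 f + ev2 d.
Proof. by move=> /DP fP /DP dP; rewrite /ev2 !ev_linear. Qed.

Lemma ev2D f d : D f -> D d -> ev2 (f + d) = ev2 f + ev2 d.
Proof. by move=> fD dD; have := ev2_linear 1 fD dD; rewrite !scale1r. Qed.

Lemma ev2B f d : D f -> D d -> ev2 (f - d) = ev2 f - ev2 d.
Proof.
by move=> fD dD; have := ev2_linear (-1) dD fD; rewrite !scaleN1r ![- _ + _]addrC.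
Qed.

Lemma ev2_0 : ev2 0 = 0.
Proof. by have := ev2B (subspace0 DS) (subspace0 DS); rewrite !subrr. Qed.

Lemma ev2_br f d : D f -> D d -> ev2 (conv (lie_br L) f d) = lie_br2 L (ev2 f) (ev2 d).
Proof.
move=> /DP fP /DP dP.
by rewrite /ev2 !(ev_conv (@lie_br_linearl _ _ L) (@lie_br_linearr _ _ L)).
Qed.

(** Coefficients of [f] and [d] in total degree [> 0] are orthogonal, so that
    [K (f, d)] is a polynomial in [u^-1]. *)
Lemma Qform_ev2 f d : D f -> D d -> (c1 - c2) * Q f d = Qbar L (ev2 f) (ev2 d).
Proof.
move=> fD dD; apply: Qform_ev => //; [exact: DP | exact: DP | move=> i l il].
by apply: (killing_filtration (fD.2 i) (dD.2 l) il).
Qed.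

Lemma Qform_ev2_eq0 f d : D f -> D d -> Q f d = 0 <-> Qbar L (ev2 f) (ev2 d) = 0.
Proof.
move=> fD dD; rewrite -Qform_ev2 //; split=> [->|/eqP]; first by rewrite mulr0.
by rewrite mulf_eq0 subr_eq0 (negPf c1_neq_c2) => /eqP.
Qed.

Lemma monomial_filtered n x : filtration L t n x -> D (monomial n x).
Proof.
move=> xn; split.
  by exists n => i; rewrite /monomial; case: eqP => // ->; rewrite ltxx.
move=> i; rewrite /monomial; case: eqP => [->//|_].
exact: (subspace0 (filtration_subspace L t i)).
Qed.

Lemma ev2_surj p : exists2 f, D f & ev2 f = p.
Proof.
(* Interpolation by [a u^-1 + b u^-2], which lies in [D] for all [a] and [b]. *)
pose b := (c1 * c2 * (c1 - c2))^-1 *: (c2 *: p.1 - c1 *: p.2).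
pose a := (c1 * c2 * (c2 - c1))^-1 *: (c2 ^+ 2 *: p.1 - c1 ^+ 2 *: p.2).
have aD : D (monomial (-1) a) by apply: monomial_filtered; apply: (filtration_full t_short).
have bD : D (monomial (-2) b) by apply: monomial_filtered; apply: (filtration_full t_short).
exists (monomial (-1) a + monomial (-2) b); first exact: (subspaceD DS aD bD).
have c12 : c1 - c2 != 0 by rewrite subr_eq0.
have c21 : c2 - c1 != 0 by rewrite subr_eq0 eq_sym.
rewrite (ev2D aD bD) /ev2 !ev_monomial; case: p @a @b {aD bD} => x y /=.
congr (_, _); rewrite /= !scalerBr !scalerA addrACA -opprD -!scalerDl.
  rewrite -[RHS](scale1r x) -[RHS]subr0 -(scale0r y).
  by congr (_ *: _ - _ *: _); rewrite -!exprnP; field; rewrite c1_neq0 c2_neq0 c12 c21.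
rewrite -[RHS](scale1r y) -[RHS]add0r -(scale0r x) -scaleNr.
by congr (_ *: _ + _ *: _); rewrite -!exprnP; field; rewrite c1_neq0 c2_neq0 c12 c21.
Qed.

(** Pairing with [y u^(1 - n) (u^-1 - c1) (u^-1 - c2)] returns [K (f n) y], and this
    polynomial lies in [D] for every [y] of weight less than [n]. *)
Lemma orthogonal_kernel f : @laurent g f ->
  (forall d, D d -> ev2 d = 0 -> Q f d = 0) -> D f.
Proof.
move=> fl fP; split=> // n; apply: (filtration_orthogonal t_short ndeg) => m y mn ym.
have -> : killing L (f n) y = Q f (two_zeros c1 c2 (1 - n) y).
  by rewrite Qform_two_zeros // subKr.
apply: fP; first by apply: (filtered_two_zeros _ _ _ ym); lia.
by rewrite /ev2 !ev_two_zeros // subrr ?mulr0 ?mul0r.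
Qed.

(** * Taylor series in the order *)

(** The subspace [Delta] in terms of the grading. *)
Definition diagonal_mod : set (g * g) :=
  [set p | [/\ filtration L t 0 p.1, filtration L t 0 p.2 &
    weight_space L t (-1) (p.1 - p.2)]].

(** The weights are at least [-1], which leaves no term in [u^n] for [n > 1]. *)
Lemma taylor_ev f c : D f -> @taylor g f -> ev c f = f 0 + c^-1 *: f 1.
Proof.
move=> fD f0; rewrite (@ev_seq _ _ _ _ [:: 0; 1]) //.
  by rewrite big_cons big_seq1 oppr0 expr0z scale1r exprN1.
move=> i; rewrite !inE negb_or => /andP[i0 i1].
have [/f0//|ige0] := ltP i 0; apply: (filtration_zero t_short _ (fD.2 i)).
by lia.
Qed.

Lemma inv_neq : c1^-1 - c2^-1 != 0.
Proof. by rewrite subr_eq0 (inj_eq invr_inj). Qed.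

Lemma ev2_taylor f : D f -> @taylor g f -> diagonal_mod (ev2 f).
Proof.
move=> fD f0; have f1 := fD.2 1; have fS := filtration_subspace L t 0.
have evf c : filtration L t 0 (f 0 + c *: f 1).
  apply: (subspaceD fS (fD.2 0)); apply: (subspaceZ c fS).
  by apply: filtration_mono f1.
split; rewrite /= !taylor_ev // opprD addrACA subrr add0r -scalerBl.
by apply: (subspaceZ _ (weight_space_subspace L t (-1))); apply/(filtration1 t_short).
Qed.

Lemma ev2_taylor_surj p : diagonal_mod p ->
  exists f, [/\ D f, @taylor g f & ev2 f = p].
Proof.
move=> [p1 p2 p12]; pose b := (c1^-1 - c2^-1)^-1 *: (p.1 - p.2).
have b1 : weight_space L t (-1) b.
  exact: (subspaceZ _ (weight_space_subspace L t (-1)) p12).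
pose a := p.1 - c1^-1 *: b.
have bD : D (monomial 1 b) by apply: monomial_filtered; apply/(filtration1 t_short).
have aD : D (monomial 0 a).
  apply: monomial_filtered; apply: (subspaceB (filtration_subspace L t 0) p1).
  apply: (subspaceZ _ (filtration_subspace L t 0)).
  exact: (weight_space_filtration _ b1).
exists (monomial 0 a + monomial 1 b); split.
- exact: (subspaceD DS aD bD).
- move=> n n0; rewrite fctE /monomial.
  by do 2![case: eqP => [ne|_]; first by lia]; rewrite addr0.
rewrite (ev2D aD bD) /ev2 !ev_monomial oppr0 !expr0z !scale1r !exprN1.
apply: injective_projections => /=; first by rewrite subrK.
have pb : p.1 - p.2 = (c1^-1 - c2^-1) *: b.
  by rewrite scalerA mulfV ?inv_neq // scale1r.
by rewrite -[p.2](subKr p.1) pb scalerBl opprB /a -addrA [- _ + _]addrC.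
Qed.

Lemma ev2_taylor_inj f : D f -> @taylor g f -> ev2 f = 0 -> f = 0.
Proof.
move=> fD f0; rewrite /ev2 !taylor_ev // => -[e1 e2].
have f1 : f 1 = 0.
  have : (c1^-1 - c2^-1) *: f 1 = 0.
    rewrite scalerBl; apply/eqP; rewrite subr_eq0; apply/eqP/(addrI (f 0)).
    by rewrite e1 e2.
  by move/eqP; rewrite scaler_eq0 (negPf inv_neq) => /eqP.
have f00 : f 0 = 0 by move: e1; rewrite f1 scaler0 addr0.
apply/funext => n; have [->//|n0] := eqVneq n 0; have [->//|n1] := eqVneq n 1.
have [/f0//|ige0] := ltP n 0; apply: (filtration_zero t_short _ (fD.2 n)).
by lia.
Qed.

(** * The correspondence *)

Definition lagrangian_loop W : Prop :=
  lagrangian_subalgebra (@laurent g) (conv (lie_br L)) Q W.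
Definition lagrangian_square X : Prop :=
  lagrangian_subalgebra [set: g * g] (lie_br2 L) (Qbar L) X.

Definition preimage_ev2 X : set (int -> g) := [set f | D f /\ X (ev2 f)].

(** [D] is orthogonal to the kernel of evaluation on [D], so [W] contains that
    kernel. *)
Lemma ev2_saturated W f : lagrangian_loop W -> W `<=` D -> D f ->
  (ev2 @` W) (ev2 f) -> W f.
Proof.
move=> [_ WS _ WE] WD fD [w Ww ewf]; rewrite -[f](subrK w).
apply: (subspaceD WS) => //; have dD := subspaceB DS fD (WD _ Ww).
rewrite WE; split; first exact: dD.1.
move=> v Wv; apply/(Qform_ev2_eq0 dD (WD _ Wv)).
rewrite (ev2B fD (WD _ Ww)) ewf subrr /Qbar /=.
by rewrite !killing0l subrr.
Qed.

Lemma image_lagrangian W : lagrangian_loop W -> W `<=` D -> lagrangian_square (ev2 @` W).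
Proof.
move=> lagW WD; have [WV WS Wbr WE] := lagW; split=> //.
- split=> [|a _ _ [f Wf <-] [d Wd <-]].
    by exists 0; [exact: (subspace0 WS) | exact: ev2_0].
  exists (a *: f + d); first by have [_] := WS; apply.
  by rewrite ev2_linear //; apply: WD.
- move=> _ _ [f Wf <-] [d Wd <-]; exists (conv (lie_br L) f d); first exact: Wbr.
  by rewrite ev2_br //; apply: WD.
apply/seteqP; split=> p.
  move=> [f Wf <-]; split=> // _ [d Wd <-].
  apply/(Qform_ev2_eq0 (WD _ Wf) (WD _ Wd)).
  by move: Wf; rewrite {1}WE => -[_]; apply.
move=> [_ pX]; have [f fD fp] := ev2_surj p; exists f => //.
rewrite WE; split=> [|d Wd]; first exact: fD.1.
by apply/(Qform_ev2_eq0 fD (WD _ Wd)); rewrite fp; apply: pX; exists d.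
Qed.

Lemma preimage_lagrangian X : lagrangian_square X -> lagrangian_loop (preimage_ev2 X).
Proof.
move=> [_ XS Xbr XE]; split.
- by move=> f [[]].
- split; first by split; [exact: (subspace0 DS) | rewrite ev2_0; exact: (subspace0 XS)].
  move=> a f d [fD fX] [dD dX]; split; first by have [_] := DS; apply.
  by rewrite ev2_linear //; have [_] := XS; apply.
- move=> f d [fD fX] [dD dX]; split; first exact: filtered_br.
  by rewrite ev2_br //; apply: Xbr.
apply/seteqP; split=> f.
  move=> [fD fX]; split=> [|d [dD dX]]; first exact: fD.1.
  apply/(Qform_ev2_eq0 fD dD).
  by move: fX; rewrite XE => -[_]; apply.
move=> [fl fP]; have fD : D f.
  apply: orthogonal_kernel => // d dD d0; apply: fP; split=> //.
  by rewrite d0; exact: (subspace0 XS).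
split=> //; rewrite XE; split=> // q qX; have [d dD dq] := ev2_surj q.
by rewrite -dq; apply/(Qform_ev2_eq0 fD dD); apply: fP; split=> //; rewrite dq.
Qed.

Lemma preimage_ev2K X : ev2 @` preimage_ev2 X = X.
Proof.
apply/seteqP; split=> [_ [f [_ fX] <-] //|p pX].
by have [f fD fp] := ev2_surj p; exists f => //; split=> //; rewrite fp.
Qed.

(** By [ev2_taylor] and [ev2_taylor_surj], evaluation maps the Taylor series in [D]
    onto [diagonal_mod]. *)
Lemma image_transversal W : lagrangian_loop W -> W `<=` D ->
  transversal_in (@laurent g) W (@taylor g) ->
  transversal_in [set: g * g] (ev2 @` W) diagonal_mod.
Proof.
move=> lagW WD [W0 WT]; have [_ XS _ _] := image_lagrangian lagW WD; split.
  apply/seteqP; split=> [p [pX pD]|_ ->].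
    have [f [fD f0 fp]] := ev2_taylor_surj pD.
    have Wf : W f by apply: ev2_saturated => //; rewrite fp.
    have : [set 0] f by rewrite -W0.
    by move=> /= fE; rewrite -fp fE ev2_0.
  split; first exact: (subspace0 XS).
  by rewrite -ev2_0; apply: ev2_taylor => //; exact: (subspace0 DS).
apply/seteqP; split=> // p _; have [d dD <-] := ev2_surj p.
have : laurent d by exact: dD.1.
rewrite -WT => -[w Ww [s s0 wsd]].
have sD : D s by rewrite -(addKr w s) wsd addrC; apply: (subspaceB DS dD (WD _ Ww)).
exists (ev2 w); first by exists w.
exists (ev2 s); first exact: ev2_taylor.
by rewrite -ev2D ?wsd //; apply: WD.
Qed.

(** A Laurent series differs by a Taylor series from its part in negative degrees,
    which lies in [D]. *)
Lemma preimage_transversal X : lagrangian_square X ->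
  transversal_in [set: g * g] X diagonal_mod ->
  transversal_in (@laurent g) (preimage_ev2 X) (@taylor g).
Proof.
move=> lagX [X0 XT]; have [_ WS _ _] := preimage_lagrangian lagX; split.
  apply/seteqP; split=> [f [[fD fX] f0]|_ ->]; last by split=> //; exact: (subspace0 WS).
  apply: ev2_taylor_inj => //; have : (X `&` diagonal_mod) (ev2 f).
    by split=> //; apply: ev2_taylor.
  by rewrite X0.
apply/seteqP; split=> [_ [f [fD _] [s s0 <-]]|f fl].
  apply: (subspaceD (laurent_is_subspace g)); first exact: fD.1.
  by exists 0.
pose f' : int -> g := fun n => if n < 0 then f n else 0.
have fD : D f'.
  split=> [|n]; first by have [N fN] := fl; exists N => n /fN; rewrite /f' => ->; case: ifP.
  rewrite /f'; case: ifP => [n0|_]; first exact: (filtration_full t_short).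
  exact: (subspace0 (filtration_subspace L t n)).
have : [set: g * g] (ev2 f') by [].
rewrite -XT => -[x xX [p pD xp]]; have [s [sD s0 sp]] := ev2_taylor_surj pD.
exists (f' - s).
  split; first exact: (subspaceB DS).
  by rewrite ev2B // sp -xp addrK.
exists (s + (f - f')); last by rewrite addrA subrK addrC subrK.
by move=> n n0; rewrite !fctE s0 // /f' n0 add0r subrr.
Qed.

Lemma loop_square_correspondence :
  set_bij [set W | [/\ lagrangian_loop W,
                       transversal_in (@laurent g) W (@taylor g) & W `<=` D]]
    [set X | lagrangian_square X /\ transversal_in [set: g * g] X diagonal_mod]
    (fun W => ev2 @` W).
Proof.
split.
- move=> W [lagW tW WD]; split; first exact: image_lagrangian.
  exact: image_transversal.
- suff sub W1 W2 : lagrangian_loop W1 -> W1 `<=` D -> W2 `<=` D ->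
      ev2 @` W1 = ev2 @` W2 -> W2 `<=` W1.
    move=> W1 W2; rewrite !inE => -[lag1 _ D1] [lag2 _ D2] e12.
    by apply/seteqP; split; apply: sub.
  move=> lag1 D1 D2 e12 f Wf; apply: ev2_saturated => //; first exact: D2.
  by rewrite e12; exists f.
move=> X [lagX tX]; exists (preimage_ev2 X); last exact: preimage_ev2K.
split; [exact: preimage_lagrangian | exact: preimage_transversal | by move=> f []].
Qed.

End Correspondence.

(** * Vanishing Killing form *)

(** For the zero form the only Lagrangian subspace is the whole space, which meets
    every subspace. *)

Section ZeroKilling.
Variables (F : fieldType) (g : vectType F) (L : lie_algebra g).
Hypothesis killing0 : forall x y, killing L x y = 0.

Lemma zero_killing_loop a W (x : g) : x != 0 ->
  lagrangian_subalgebra (@laurent g) (conv (lie_br L)) (Qform L a) W ->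
  ~ transversal_in (@laurent g) W (@taylor g).
Proof.
move=> x0 [_ _ _ WE] [W0 _]; move/eqP: x0; apply.
have Wx : W (monomial 0 x).
  rewrite WE; split=> [|d _]; first by exists 0 => n; rewrite /monomial; case: eqP => // ->.
  rewrite /Qform /residue /conv fsbig1 // => i _.
  by rewrite fsbig1 ?mulr0.
have : (W `&` @taylor g) (monomial 0 x).
  by split=> // n; rewrite /monomial; case: eqP => // ->.
by rewrite W0 => /(congr1 (fun f => f 0)); rewrite /monomial eqxx.
Qed.

Lemma zero_killing_square X Y (p : g * g) : p != 0 -> Y p ->
  lagrangian_subalgebra [set: g * g] (lie_br2 L) (Qbar L) X ->
  ~ transversal_in [set: g * g] X Y.
Proof.
move=> p0 Yp [_ _ _ XE] [X0 _]; move/eqP: p0; apply.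
have : (X `&` Y) p by split=> //; rewrite XE; split=> // q _; rewrite /Qbar !killing0 subrr.
by rewrite X0.
Qed.

End ZeroKilling.

Local Open Scope complex_scope.

Theorem theorem2p3 (R : realType) (g : vectType R[i]) (L : lie_algebra g)
    (simple_g : is_simple L)
    (H : {vspace g}) (cartan_H : is_cartan L H)
    (r : nat) (Gamma : r.-tuple (dual_space H))
    (simple_Gamma : is_simple_system L Gamma)
    (alpha_max : dual_space H) (max_alpha_max : is_maximal_root L Gamma alpha_max)
    (j : 'I_r) (k : nat) (def_k : coord Gamma j alpha_max = k%:R)
    (h : subvs_of H) (def_h : is_order_point L Gamma j k h)
    (c1 c2 : R[i]) (c1_neq0 : c1 != 0) (c2_neq0 : c2 != 0) (c1_neq_c2 : c1 != c2) :
  let subalgebras_W : set (set (int -> g)) :=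
    [set W | [/\ lagrangian_subalgebra (@laurent g) (conv (lie_br L))
                   (Qform L (a_series c1 c2)) W,
                 transversal_in (@laurent g) W (@taylor g) &
                 W `<=` O_ L h `&` @laurent_poly g]] in
  let subalgebras_gg : set (set (g * g)) :=
    [set X | lagrangian_subalgebra [set: g * g] (lie_br2 L) (Qbar L) X /\
             transversal_in [set: g * g] X (Delta L Gamma j)] in
  (k = 1%N ->
     exists Phi : set (int -> g) -> set (g * g),
       set_bij subalgebras_W subalgebras_gg Phi) /\
  ((1 < k)%N -> ~ exists W, subalgebras_W W).
Proof.
move=> subalgebras_W subalgebras_gg.
have [_ Groot _] := simple_Gamma.
have [t t0] : exists t : subvs_of H, vsval t != 0.
  have [/lfunPn[t Gt] _] := Groot j; exists t; apply: contraNneq Gt => t0.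
  have -> : t = 0 by apply: subvs_inj; rewrite t0 linear0.
  by rewrite !linear0.
have [ndeg|killing0] := simple_killing simple_g; last first.
  have W0 : subalgebras_W = set0.
    apply/seteqP; split=> // W [lagW tW _].
    exact: (zero_killing_loop killing0 t0 lagW tW).
  have X0 : subalgebras_gg = set0.
    apply/seteqP; split=> // X [lagX tX].
    have tD : Delta L Gamma j (vsval t, vsval t).
      have tH : [set` H] (vsval t) by apply: subvsP.
      split; [by apply: sub_lspan; left | by apply: sub_lspan; left |].
      exists (vsval t); split; rewrite /= ?subrr;
        by [apply: sub_lspan; left | apply: (subspace0 (lspan_is_subspace _))].
    apply: (zero_killing_square killing0 _ tD lagX tX).
    by apply: contra t0 => /eqP[->].
  split=> [_|_ [W]]; last by rewrite W0.
  by exists (fun=> set0); rewrite W0 X0; split=> [W []|W1 W2|X []]; rewrite inE.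
split=> [k1|k_gt1 [W [lagW _ WO]]]; last first.
  exact: (no_lagrangian_in_order ndeg cartan_H simple_Gamma def_h c1_neq0 c2_neq0
    c1_neq_c2 k_gt1 lagW WO).
move: def_k def_h; rewrite k1 => theta1 h1.
have t_short := order_point_short ndeg cartan_H simple_Gamma max_alpha_max theta1 h1.
exists (fun W => ev2 c1 c2 @` W).
have := loop_square_correspondence ndeg t_short c1_neq0 c2_neq0 c1_neq_c2.
rewrite /subalgebras_W /subalgebras_gg.
rewrite (order_filtered ndeg cartan_H simple_Gamma max_alpha_max theta1 h1).
have -> : Delta L Gamma j = diagonal_mod L (vsval h).
  apply/seteqP; split=> p;
    by move/(DeltaE ndeg cartan_H simple_Gamma max_alpha_max theta1 h1).
by [].
Qed.
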